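(* For any $(k+1)$-dimensional simplex $\Delta$ with a sequence of heights $h_1,h_2,\ldots,h_k$ (where $k$ is a positive integer), if $\min_{i}h_i>\rho(\Delta)$, then there exists some $n_0=n_0(\Delta)$ such that for any $n\ge n_0$ and any positive integer $r$, $\mathbb{E}^n\overset{r}{\rightarrow}(\Delta;\Delta)_{\mathrm{GR}}$.
   Context: $\mathbb{E}^n$ denotes $n$-dimensional Euclidean space. An $r$-coloring of $\mathbb{E}^n$ is an assignment to each point of one of $r$ colors (not all colors need be used). A set of points is monochromatic if all its points have the same color, and rainbow if its points have pairwise distinct colors. A simplex is identified with its (affinely independent) vertex set. A simplex $\Delta$ formed by points $\boldsymbol{x}_1,\ldots,\boldsymbol{x}_{k+2}$ has sequence of heights $h_1,\ldots,h_k$ if for each $3\le i\le k+2$ the distance from $\boldsymbol{x}_i$ to the affine space spanned by $\boldsymbol{x}_1,\ldots,\boldsymbol{x}_{i-1}$ is $h_{i-2}$. The circumradius $\rho(\Delta)$ is the smallest radius among all spheres (surfaces) that contain $\Delta$ as a subset. $\mathbb{E}^n\overset{r}{\rightarrow}(K_1;K_2)_{\mathrm{GR}}$ means that every $r$-coloring of $\mathbb{E}^n$ contains either a monochromatic set congruent (isometric) to $K_1$ or a rainbow set congruent to $K_2$. *)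

(* Defs.v *)
From HB Require Import structures.
From mathcomp Require Import all_boot all_order all_algebra.
From mathcomp Require Import boolp classical_sets functions reals.

Set Implicit Arguments.
Unset Strict Implicit.
Unset Printing Implicit Defensive.

Import Order.TTheory GRing.Theory Num.Theory.
Local Open Scope classical_set_scope.
Local Open Scope ring_scope.

(* The norm that MathComp-Analysis puts on matrices is the sup norm, hence
   this explicit Euclidean distance on 'rV[R]_n. *)
Definition euclidean_dist (R : realType) (n : nat) (x y : 'rV[R]_n) : R :=
  Num.sqrt (\sum_(i < n) (x ord0 i - y ord0 i) ^+ 2).

Definition dist_to_set (R : realType) (n : nat) (p : 'rV[R]_n)
    (A : set 'rV[R]_n) : R :=
  inf [set euclidean_dist p y | y in A].

Definition affine_span (R : realType) (n m : nat) (P : pred 'I_m)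
    (x : 'I_m -> 'rV[R]_n) : set 'rV[R]_n :=
  [set y | exists a : 'I_m -> R,
     \sum_(j < m | P j) a j = 1 /\ y = \sum_(j < m | P j) a j *: x j].

Definition affinely_independent (R : realType) (n m : nat)
    (x : 'I_m -> 'rV[R]_n) : Prop :=
  forall a : 'I_m -> R,
    \sum_(j < m) a j = 0 -> \sum_(j < m) a j *: x j = 0 ->
    forall j, a j = 0.

(* Indices are shifted by one: [lift ord0 (lift ord0 i)] is i + 2, so h i is
   the distance from x_(i+2) to the affine span of x_0, ..., x_(i+1). *)
Definition has_heights (R : realType) (n k : nat)
    (x : 'I_k.+2 -> 'rV[R]_n) (h : 'I_k -> R) : Prop :=
  forall i : 'I_k,
    let l : 'I_k.+2 := lift ord0 (lift ord0 i) in
    dist_to_set (x l) (affine_span (fun j => (j < l)%N) x) = h i.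

Definition sphere (R : realType) (n : nat) (c : 'rV[R]_n) (rho : R) :
    set 'rV[R]_n :=
  [set y | euclidean_dist c y = rho].

(* For the vertex set of a simplex, the only case of interest, the infimum is
   attained. *)
Definition circumradius (R : realType) (n : nat) (K : set 'rV[R]_n) : R :=
  inf [set rho | exists c : 'rV[R]_n, K `<=` sphere c rho].

Definition congruent (R : realType) (m n : nat) (K : set 'rV[R]_m)
    (A : set 'rV[R]_n) : Prop :=
  exists f : 'rV[R]_m -> 'rV[R]_n,
    f @` K = A /\
    forall x y, K x -> K y ->
      euclidean_dist (f x) (f y) = euclidean_dist x y.

Definition monochromatic (T C : Type) (c : T -> C) (A : set T) : Prop :=
  forall x y, A x -> A y -> c x = c y.

Definition rainbow (T C : Type) (c : T -> C) (A : set T) : Prop :=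
  set_inj A c.

Definition GR_arrow (R : realType) (n r m1 m2 : nat) (K1 : set 'rV[R]_m1)
    (K2 : set 'rV[R]_m2) : Prop :=
  forall c : 'rV[R]_n -> 'I_r,
    (exists A : set 'rV[R]_n, congruent K1 A /\ monochromatic c A) \/
    (exists A : set 'rV[R]_n, congruent K2 A /\ rainbow c A).

(* Main.v *)
Require Import Defs.
From HB Require Import structures.
From mathcomp Require Import all_boot all_order all_algebra.
From mathcomp Require Import boolp classical_sets functions reals.
From mathcomp Require Import ring lra zify.
(** Write N = k+2 for the number of vertices of the simplex and rho for its
circumradius.

A rainbow copy is built one vertex at a time.  If all pairs of points at the
length of the first edge had equal colors, the whole space would have one color
(the graph of that distance is connected) and a monochromatic copy would exist;
so the first edge can be chosen with two colors.  Once l >= 2 vertices are placed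
with distinct colors, the points completing them congruently form a sphere whose
radius is the next height h.  Either this sphere shows a new color, and the
rainbow simplex grows, or it is colored with the l < N colors already used.
In the second case lemma sphere_ramsey applies, as h > rho: a sphere of radius
greater than rho and of large dimension, colored with a bounded number of colors,
contains a monochromatic congruent copy of the simplex.  The number of colors
given to that lemma is at most N + 1 whatever r is, hence n0 is independent of r.

The sphere statement is a theorem of Matousek and Rodl.  Fix a word a, that is, a
finite sequence of nonzero reals.  Ramsey's theorem for subsets of size |a| makes
all vectors obtained from a by inserting zeros between its letters, at positions
of a large set, monochromatic.  It remains to find N such spreads of one word with
the Gram matrix M_ij = H^2 - |x_i - x_j|^2 / 2: they then lie on the sphere of
radius H and form a copy of the simplex.  With c the circumcenter,
M_ij = (H^2 - rho^2) + <x_i - c, x_j - c>, so H > rho and affine independence make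
M positive definite.

Gram matrices of spreads form a convex cone, by concatenation of words.  Two
facts about this cone suffice.  First, it contains every symmetric matrix with
constant, sufficiently dominant diagonal (spreadable_dominated).  Second, it comes
arbitrarily close to the Gram matrix of any N vectors of norm at most 1, up to
enlarging the diagonal (spreadable_approx).  An exact representation of M follows
by approximating M - (l/2) I and absorbing the error in (l/2) I
(spreadable_gram).

For the second fact one needs a word T that looks like its own multiples: T is the
superposition, over a geometric progression of values d, of combs of d^2 equally
spaced letters 1/d on the unit interval.  Multiplication by m turns the comb
of (m d)^2 letters 1/(m d) into (m d)^2 letters 1/d, which are exactly the letters
1/d in m^2 consecutive copies of T.  So, up to the boundary levels, m T is a
subsequence of T repeated m^2 times, whereas the energy (sum of squares) is spread
evenly over the levels and the boundary is negligible (comb_word_subseq, comb_word_energy).  A vector with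
coordinates m_p / S, where the sum of the m_p^2 is at most S^2, is then
represented by the concatenation of the words m_p T, which embeds in S^2 copies of
T, and inner products of such vectors become inner products of the words.
Negative coordinates are obtained by replacing each letter by a long alternating
block and shifting that block by one position. *)

Set Implicit Arguments.
Unset Strict Implicit.
Unset Printing Implicit Defensive.

Import Order.TTheory GRing.Theory Num.Theory.
Local Open Scope classical_set_scope.
Local Open Scope ring_scope.

(** * Ramsey's theorem for subsequences *)

(** The color of a (k+1)-subsequence of [Y] depends on its first letter only; [cs]
lists these colors. *)
Fixpoint end_homogeneous (T : eqType) (C : Type) (chi : seq T -> C) (k : nat)
    (Y : seq T) (cs : seq C) : Prop :=
  match Y, cs with
  | x :: Y', c :: cs' =>
      (forall Z, subseq Z Y' -> size Z = k -> chi (x :: Z) = c) /\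
      end_homogeneous chi k Y' cs'
  | _, _ => True
  end.

Lemma sum_count_mem (C : finType) (cs : seq C) :
  (\sum_(c : C) count_mem c cs = size cs)%N.
Proof.
elim: cs => [|a cs IH] /=; first by rewrite big1.
rewrite big_split /= IH (bigD1 a) //= eqxx big1 ?addn0 // => c.
by rewrite eq_sym => /negbTE ->.
Qed.

Lemma frequent_color (C : finType) (s : nat) (cs : seq C) :
  (#|C| * s < size cs)%N -> exists c, (s <= count_mem c cs)%N.
Proof.
move=> lt_cs; apply: contrapT => no_c.
have: (size cs <= #|C| * s)%N.
  rewrite -sum_count_mem -sum_nat_const; apply: leq_sum => c _.
  by rewrite leqNgt; apply/negP => lt_s; apply: no_c; exists c; apply: ltnW.
by rewrite leqNgt lt_cs.
Qed.

(** Keeping the letters whose associated color is [c] turns end-homogeneity into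
homogeneity. *)
Lemma end_homogeneous_mask (T : eqType) (C : eqType) (chi : seq T -> C) k c Y cs :
  size Y = size cs -> end_homogeneous chi k Y cs ->
  forall Z, subseq Z (mask [seq d == c | d <- cs] Y) -> size Z = k.+1 ->
    chi Z = c.
Proof.
elim: Y cs => [|x Y IH] [|d cs] //=.
  by move=> _ _ [].
move=> [size_cs] [hom_x hom_Y] [//|z Z].
case: (d =P c) => [d_c|_] /=; last by move=> sub_Z; apply: IH sub_Z.
case: eqP => [-> sub_Z [size_Z]|_ sub_Z size_Z].
  by rewrite -d_c; apply: hom_x size_Z; apply: subseq_trans sub_Z (mask_subseq _ _).
exact: IH sub_Z size_Z.
Qed.

(** Working with subsequences of an arbitrary list avoids an order on the ground
set. The step from k to k+1 first extracts, greedily, a long end-homogeneous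
subsequence: the first letter x is kept and Ramsey's theorem for k is applied to the
coloring of Z by the color of x :: Z. Then the most frequent first-letter color is
selected. *)
Theorem ramsey (C : finType) (k s : nat) : exists n : nat,
  forall (T : eqType) (chi : seq T -> C) (X : seq T), (n <= size X)%N ->
  exists Y, [/\ subseq Y X, size Y = s &
    exists c, forall Z, subseq Z Y -> size Z = k -> chi Z = c].
Proof.
elim: k s => [|k IHk] s.
  exists s => T chi X le_s; exists (take s X); split.
  - exact: take_subseq.
  - by rewrite size_takel.
  - by exists (chi [::]) => -[].
have [n Hn] : exists n, forall (T : eqType) (chi : seq T -> C) (X : seq T),
    (n <= size X)%N -> exists Y cs, [/\ subseq Y X, size Y = (#|C| * s).+1,
      size cs = (#|C| * s).+1 & end_homogeneous chi k Y cs].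
  elim: (#|C| * s).+1 => [|t [n Hn]].
    by exists 0%N => T chi X _; exists [::], [::]; rewrite sub0seq.
  have [n' Hn'] := IHk n.
  exists n'.+1 => T chi [//|x X] /= le_n'.
  have [Y [sub_Y size_Y [c hom_Y]]] := Hn' T (fun Z => chi (x :: Z)) X le_n'.
  have [|W [cs [sub_W size_W size_cs hom_W]]] := Hn T chi Y; first by rewrite size_Y.
  exists (x :: W), (c :: cs); split=> /=.
  - by rewrite eqxx; apply: subseq_trans sub_W sub_Y.
  - by rewrite size_W.
  - by rewrite size_cs.
  - split=> // Z sub_Z; apply: hom_Y; exact: subseq_trans sub_Z sub_W.
exists n => T chi X /(Hn T chi) [Y [cs [sub_Y size_Y size_cs hom_Y]]].
have [|c le_c] := @frequent_color C s cs; first by rewrite size_cs.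
set W := mask [seq d == c | d <- cs] Y.
have size_W : (s <= size W)%N.
  by rewrite /W size_mask ?size_map ?size_Y // count_map.
exists (take s W); split.
- exact: subseq_trans (take_subseq _ _) (subseq_trans (mask_subseq _ _) sub_Y).
- by rewrite size_takel.
- exists c => Z sub_Z; apply: (end_homogeneous_mask _ hom_Y).
    by rewrite size_Y.
  exact: subseq_trans sub_Z (take_subseq _ _).
Qed.

(** * The cone of Gram matrices of spreads of a word *)

Definition nonzeros (R : nzRingType) (s : seq R) : seq R := [seq v <- s | v != 0].

Definition coords (R : Type) (N : nat) (cols : seq ('I_N -> R)) (i : 'I_N) : seq R :=
  [seq c i | c <- cols].

Definition gram_cols (R : nzRingType) (N : nat) (cols : seq ('I_N -> R))
  (i j : 'I_N) : R := \sum_(c <- cols) c i * c j.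

(** [M] is the Gram matrix of N vectors that all arise from one word [a] by inserting
zeros. The list [cols] gives the vectors column by column, one entry per position. *)
Definition spreadable (R : realType) (N : nat) (M : 'M[R]_N) : Prop :=
  exists (a : seq R) (cols : seq ('I_N -> R)),
    (forall i, nonzeros (coords cols i) = a) /\
    (forall i j, M i j = gram_cols cols i j).

Lemma subseq_cons_split (T : eqType) (x : T) (s a : seq T) :
  subseq (x :: s) a -> exists a1 a2, a = a1 ++ x :: a2 /\ subseq s a2.
Proof.
elim: a => [//|y a IH] /=; case: eqP => [-> sub|_ /IH [a1 [a2 [-> sub]]]].
  by exists [::], a.
by exists (y :: a1), a2.
Qed.

Section Cone.
Variables (R : realType) (N : nat).
Implicit Types (M : 'M[R]_N) (cols : seq ('I_N -> R)) (a : seq R).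

Lemma sum_sqr_nonzeros (w : seq R) :
  \sum_(v <- nonzeros w) v ^+ 2 = \sum_(v <- w) v ^+ 2.
Proof.
rewrite big_filter big_mkcond; apply: eq_bigr => v _.
by case: eqP => // ->; rewrite expr0n.
Qed.

Lemma nonzeros_coords_cat cols1 cols2 i :
  nonzeros (coords (cols1 ++ cols2) i)
  = nonzeros (coords cols1 i) ++ nonzeros (coords cols2 i).
Proof. by rewrite /nonzeros /coords map_cat filter_cat. Qed.

Lemma nonzeros_coords_cons c cols i :
  nonzeros (coords (c :: cols) i)
  = (if c i != 0 then [:: c i] else [::]) ++ nonzeros (coords cols i).
Proof. by rewrite /nonzeros /=; case: ifP. Qed.

Lemma gram_cols_cat cols1 cols2 i j :
  gram_cols (cols1 ++ cols2) i j = gram_cols cols1 i j + gram_cols cols2 i j.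
Proof. by rewrite /gram_cols big_cat. Qed.

Lemma gram_cols_cons c cols i j :
  gram_cols (c :: cols) i j = c i * c j + gram_cols cols i j.
Proof. by rewrite /gram_cols big_cons. Qed.

Lemma spreadable0 : spreadable (0 : 'M[R]_N).
Proof. by exists [::], [::]; split=> [//|i j]; rewrite /gram_cols big_nil mxE. Qed.

Lemma spreadableD M1 M2 : spreadable M1 -> spreadable M2 -> spreadable (M1 + M2).
Proof.
move=> [a1 [cols1 [row1 gram1]]] [a2 [cols2 [row2 gram2]]].
exists (a1 ++ a2), (cols1 ++ cols2); split=> [i|i j].
  by rewrite /nonzeros /coords map_cat filter_cat; congr cat; [apply: row1|apply: row2].
by rewrite mxE gram1 gram2 gram_cols_cat.
Qed.

(** The word is multiplied by the square root of [s]. *)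
Lemma spreadableZ (s : R) M : 0 <= s -> spreadable M -> spreadable (s *: M).
Proof.
rewrite le_eqVlt => /predU1P[<- _|s_gt0 [a [cols [row_a gram_M]]]].
  by rewrite scale0r; apply: spreadable0.
have r_gt0 : 0 < Num.sqrt s by rewrite sqrtr_gt0.
exists [seq Num.sqrt s * v | v <- a], [seq (fun i => Num.sqrt s * c i) | c <- cols].
split=> [i|i j].
  rewrite -(row_a i) /nonzeros /coords -map_comp !filter_map -map_comp.
  congr map; apply: eq_filter => c /=.
  by rewrite mulf_eq0 gt_eqF.
rewrite mxE gram_M /gram_cols big_map big_distrr; apply: eq_bigr => c _ /=.
by rewrite mulrACA -expr2 sqr_sqrtr // ltW.
Qed.

Lemma spreadable_sum (I : Type) (r : seq I) (P : pred I) (F : I -> 'M[R]_N) :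
  (forall i, P i -> spreadable (F i)) -> spreadable (\sum_(i <- r | P i) F i).
Proof. by move=> H; elim/big_ind: _ => //; [apply: spreadable0|apply: spreadableD]. Qed.

(** A position at which only the [i]-th vector is nonzero. Such positions lengthen one
row without affecting the inner products between different rows. *)
Definition lone_col (i : 'I_N) (v : R) : 'I_N -> R := fun j => if j == i then v else 0.

Lemma coords_lone i a : coords [seq lone_col i v | v <- a] i = a.
Proof.
rewrite /coords -map_comp -[RHS]map_id; apply: eq_map => v.
by rewrite /= /lone_col eqxx.
Qed.

Lemma nonzeros_lone i j a : j != i ->
  nonzeros (coords [seq lone_col i v | v <- a] j) = [::].
Proof.
by move=> /negbTE ji; elim: a => //= v a IH; rewrite /lone_col ji eqxx.
Qed.

Lemma gram_lone i j l a : j != l -> gram_cols [seq lone_col i v | v <- a] j l = 0.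
Proof.
move=> jl; rewrite /gram_cols big_map big1 // => v _; rewrite /lone_col.
case: (j =P i) => [ji|]; last by rewrite mul0r.
by rewrite -ji eq_sym (negbTE jl) mulr0.
Qed.

(** A row whose letters form a subsequence of [a] is completed to [a] by inserting
lone columns. *)
Lemma complete_row i cols a :
    all (fun v => v != 0) a -> subseq (nonzeros (coords cols i)) a ->
  exists cols', [/\ nonzeros (coords cols' i) = a,
    (forall j, j != i -> nonzeros (coords cols' j) = nonzeros (coords cols j)) &
    (forall j l, j != l -> gram_cols cols' j l = gram_cols cols j l)].
Proof.
elim: cols a => [|c cols IH] a a_neq0 sub_a.
  exists [seq lone_col i v | v <- a]; split=> [|j ji|j l jl].
  - by rewrite coords_lone; apply/all_filterP.
  - exact: nonzeros_lone.
  - by rewrite gram_lone // /gram_cols big_nil.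
move: sub_a; rewrite nonzeros_coords_cons.
case: (eqVneq (c i) 0) => [ci0|ci_neq0] /= sub_a.
  have [cols' [row_i row_j gram_jl]] := IH a a_neq0 sub_a.
  exists (c :: cols'); split=> [|j ji|j l jl].
  - by rewrite nonzeros_coords_cons ci0 eqxx.
  - by rewrite nonzeros_coords_cons row_j //; case: ifP.
  - by rewrite !gram_cols_cons gram_jl.
move: sub_a => /subseq_cons_split [a1 [a2 [a_eq sub_a2]]].
move: a_neq0; rewrite a_eq all_cat /= => /and3P [a1_neq0 _ a2_neq0].
have [cols' [row_i row_j gram_jl]] := IH a2 a2_neq0 sub_a2.
exists ([seq lone_col i v | v <- a1] ++ c :: cols'); split=> [|j ji|j l jl].
- rewrite nonzeros_coords_cat nonzeros_coords_cons ci_neq0 row_i coords_lone.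
  by congr cat; apply/all_filterP.
- by rewrite nonzeros_coords_cat nonzeros_coords_cons row_j // nonzeros_lone //; case: ifP.
- by rewrite gram_cols_cat !gram_cols_cons gram_jl // gram_lone // add0r.
Qed.

Lemma complete_rows cols a :
    all (fun v => v != 0) a ->
    (forall i, subseq (nonzeros (coords cols i)) a) ->
  exists cols', (forall i, nonzeros (coords cols' i) = a) /\
    (forall j l, j != l -> gram_cols cols' j l = gram_cols cols j l).
Proof.
move=> a_neq0 sub_a.
suff [cols' [row_a _ gram_jl]] : exists cols',
    [/\ forall i, i \in enum 'I_N -> nonzeros (coords cols' i) = a,
    forall i, subseq (nonzeros (coords cols' i)) a &
    forall j l, j != l -> gram_cols cols' j l = gram_cols cols j l].
  by exists cols'; split=> // i; apply: row_a; rewrite mem_enum.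
elim: (enum 'I_N) => [|i r [cols' [row_r sub_cols' gram_jl]]]; first by exists cols.
have [cols'' [row_i row_j gram_jl']] := complete_row a_neq0 (sub_cols' i).
exists cols''; split=> [j|j|j l jl].
- by case: (eqVneq j i) => [->//|ji]; rewrite in_cons (negbTE ji) row_j //; apply: row_r.
- by case: (eqVneq j i) => [->|ji]; [rewrite row_i|rewrite row_j].
- by rewrite gram_jl' // gram_jl.
Qed.

(** It suffices that each row be a subsequence of [a]: the missing letters are put in
lone columns, which only raises the diagonal, to the energy of [a]. *)
Lemma spreadable_subseq cols a :
    all (fun v => v != 0) a ->
    (forall i, subseq (nonzeros (coords cols i)) a) ->
  spreadable (\matrix_(i, j) if i == j then \sum_(v <- a) v ^+ 2
                             else gram_cols cols i j).
Proof.
move=> a_neq0 /(complete_rows a_neq0) [cols' [row_a gram_jl]].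
exists a, cols'; split=> // i j; rewrite mxE; case: eqVneq => [<-|ij].
  rewrite -(row_a i) sum_sqr_nonzeros /gram_cols big_map.
  by apply: eq_bigr => c _; rewrite expr2.
by rewrite gram_jl.
Qed.

Lemma spreadable1 : spreadable (1%:M : 'M[R]_N).
Proof.
have := @spreadable_subseq [::] [:: 1].
rewrite /= oner_neq0 => /(_ isT (fun=> isT)).
congr spreadable; apply/matrixP => i j; rewrite !mxE big_seq1 expr1n.
by case: eqP => // _; rewrite /gram_cols big_nil.
Qed.

(** Two rows share one position and nothing else. A negative inner product comes from
the word (1, -1), the last letter of one row meeting the first letter of the other. *)
Lemma spreadable_pair (p q : 'I_N) (b : bool) : p != q ->
  spreadable (2%:M + (-1) ^+ b *: (delta_mx p q + delta_mx q p) : 'M[R]_N).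
Proof.
move=> pq; set e : R := (-1) ^+ b.
have e_neq0 : e != 0 by rewrite signr_eq0.
set c : 'I_N -> R := fun i => if i == p then 1 else if i == q then e else 0.
have /(_ [:: c] [:: 1; e]) := @spreadable_subseq.
rewrite /= oner_neq0 e_neq0 => /(_ isT) H.
have sub i : subseq (nonzeros (coords [:: c] i)) [:: 1; e].
  rewrite /nonzeros /= /c; case: (i == p); first by rewrite oner_neq0 /= eqxx.
  case: (i == q); last by rewrite eqxx.
  by rewrite e_neq0; apply: (@suffix_subseq _ [:: 1] [:: e]).
move: {H sub} (H sub); congr spreadable; apply/matrixP => i j; rewrite !mxE.
rewrite big_cons big_seq1 /e sqrr_sign expr1n /gram_cols big_seq1 /c -/e.
case: (eqVneq i j) => [<-|ij].
  case: (eqVneq i p) => [->|ip]; first by rewrite (negbTE pq) !addr0 mulr0 addr0.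
  by rewrite andbF addr0 mulr0 addr0.
case: (eqVneq i p) ij => [->|ip] ij; rewrite ?(negbTE pq) ?mul1r ?add0r /=.
  rewrite [j == p]eq_sym (negbTE ij) [j == q]eq_sym.
  by case: (q == j); rewrite /= ?addr0 ?mulr1 ?mulr0.
case: (eqVneq i q) ij => [->|iq] ij; last by rewrite mul0r mulr0.
by case: (j == p) => //=; rewrite [j == q]eq_sym (negbTE ij).
Qed.

Lemma sum_offdiag_delta (F : 'I_N -> 'I_N -> R) (i j : 'I_N) :
  \sum_p \sum_(q | q != p) F p q * ((i == p) && (j == q))%:R
  = if i == j then 0 else F i j.
Proof.
rewrite (bigD1 i) //= [X in _ + X]big1 ?addr0 => [|p /negbTE pi]; last first.
  by rewrite big1 // => q _; rewrite eq_sym pi mulr0.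
case: (eqVneq i j) => [<-|ij].
  by rewrite big1 // => q /negbTE qi; rewrite [i == q]eq_sym qi andbF mulr0.
rewrite (bigD1 j) 1?eq_sym //= !eqxx mulr1 big1 ?addr0 // => q /andP[_ /negbTE qj].
by rewrite [j == q]eq_sym qj andbF mulr0.
Qed.

(** Such a matrix is a nonnegative combination of the matrices of [spreadable_pair],
one for each off-diagonal entry, and of the identity. *)
Lemma spreadable_dominated (D : 'M[R]_N) (c e : R) : 0 <= e ->
    (forall i j, D i j = D j i) -> (forall i, D i i = c) ->
    (forall i j, i != j -> `|D i j| <= e) -> e * (N * N)%:R <= c -> 
  spreadable D.
Proof.
move=> e_ge0 D_sym D_diag D_le le_c.
pose E (p q : 'I_N) : 'M[R]_N :=
  2%:M + (-1) ^+ (D p q < 0)%R *: (delta_mx p q + delta_mx q p).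
pose S : 'M[R]_N := \sum_p \sum_(q | q != p) (`|D p q| / 2) *: E p q.
pose d : R := \sum_p \sum_(q | q != p) `|D p q|.
have S_spread : spreadable S.
  apply: spreadable_sum => p _; apply: spreadable_sum => q qp.
  apply: spreadableZ; first by rewrite divr_ge0.
  by apply: spreadable_pair; rewrite eq_sym.
have d_le : d <= c.
  apply: le_trans le_c.
  have -> : e * (N * N)%:R = \sum_(p < N) \sum_(q < N) e.
    by rewrite !sumr_const !card_ord mulr_natr mulrnA.
  apply: ler_sum => p _.
  rewrite [leRHS](bigD1 p) //= -[leLHS]add0r; apply: lerD => //.
  by apply: ler_sum => q qp; apply: D_le; rewrite eq_sym.
suff -> : D = S + (c - d)%:M.
  apply: spreadableD => //; rewrite -scalemx1; apply: spreadableZ spreadable1.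
  by rewrite subr_ge0.
have SE i j : S i j = d *+ (i == j) +
    \sum_p \sum_(q | q != p) D p q / 2 * ((i == p) && (j == q))%:R +
    \sum_p \sum_(q | q != p) D p q / 2 * ((j == p) && (i == q))%:R.
  rewrite /d -sumrMnl -!big_split /= summxE; apply: eq_bigr => p _.
  rewrite -sumrMnl -!big_split /= summxE; apply: eq_bigr => q _.
  rewrite !mxE -addrA -mulrDr [(j == p) && _]andbC {4}[D p q]numEsign //.
  by set e1 := (-1) ^+ _; case: (i == j); rewrite ?mulr1n ?mulr0n; field.
apply/matrixP => i j; rewrite !mxE SE.
rewrite !(sum_offdiag_delta (fun p q => D p q / 2)) [j == i]eq_sym.
case: (eqVneq i j) => [<-|ij].
  by rewrite D_diag !addr0 addrC subrK.
by rewrite !mulr0n add0r addr0 [D j i]D_sym -splitr.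
Qed.

End Cone.

(** * Words that embed in repetitions of themselves after scaling *)

(** A superposition of combs, read off on a grid of [Z] instants. Simultaneous letters
are written in the order of [levels]. *)
Definition comb (T : Type) (levels : seq nat) (P : nat -> nat) (v : nat -> T)
    (Z : nat) : seq T :=
  flatten [seq [seq v u | u <- levels & (P u %| c)%N] | c <- iota 0 Z].

Lemma combS (T : Type) levels P (v : nat -> T) Z :
  comb levels P v Z.+1 = comb levels P v Z ++ [seq v u | u <- levels & (P u %| Z)%N].
Proof. by rewrite /comb -addn1 iotaD map_cat flatten_cat /= cats0. Qed.

(** A finer time grid only adds instants without letters. *)
Lemma comb_refine (T : Type) levels P (v : nat -> T) q Z : (0 < q)%N ->
  comb levels (fun u => q * P u)%N v (q * Z) = comb levels P v Z.
Proof.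
move=> q_gt0; elim: Z => [|Z IH]; first by rewrite muln0.
rewrite combS -IH mulnS addnC /comb iotaD add0n map_cat flatten_cat; congr cat.
case: q q_gt0 {IH} => [//|q] _ /=.
rewrite -[RHS]cats0; congr cat.
  by congr map; apply: eq_filter => u; rewrite dvdn_pmul2l.
apply/nilP; rewrite /nilp size_flatten /shape -map_comp sumnE big_map.
rewrite big1_seq // => c; rewrite mem_iota /= size_map size_filter => /andP[lt_c c_lt].
apply/eqP; rewrite -leqn0 leqNgt -has_count; apply/hasPn => u _ /=.
apply/negP => /(dvdn_trans (dvdn_mulr _ (dvdnn q.+1))).
have /subnKC <- := ltnW lt_c; rewrite dvdn_addr ?dvdn_mulr // gtnNdvd //.
  by rewrite subn_gt0.
by rewrite ltn_subLR ?(ltnW lt_c) // addnS -addSn.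
Qed.

Lemma comb_repeat (T : Type) levels P (v : nat -> T) m Z :
    all (fun u => P u %| Z)%N levels ->
  comb levels P v (m * Z) = flatten (nseq m (comb levels P v Z)).
Proof.
move=> dvd_Z; elim: m => [//|m IH].
rewrite mulSnr /comb iotaD map_cat flatten_cat -/(comb _ _ _ _) IH.
rewrite -[m.+1]addn1 nseqD flatten_cat /= cats0; congr cat.
rewrite addnC iotaDl -map_comp; congr flatten; apply: eq_map => c /=.
congr map; apply: eq_in_filter => u /(allP dvd_Z) dvd_u.
by rewrite dvdn_addr // dvdn_mull.
Qed.

Lemma subseq_flatten_map (T : eqType) (I : Type) (f g : I -> seq T) (s : seq I) :
  (forall i, subseq (f i) (g i)) ->
  subseq (flatten [seq f i | i <- s]) (flatten [seq g i | i <- s]).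
Proof. by move=> sub; elim: s => //= i s IH; apply: cat_subseq. Qed.

Lemma comb_subseq (T : eqType) levels levels' P (v : nat -> T) Z :
  subseq levels levels' -> subseq (comb levels P v Z) (comb levels' P v Z).
Proof.
move=> sub; apply: subseq_flatten_map => c; apply: map_subseq.
rewrite subseq_filter filter_all; exact: subseq_trans (filter_subseq _ _) sub.
Qed.

Lemma map_comb (T U : Type) (f : T -> U) levels P (v : nat -> T) Z :
  [seq f w | w <- comb levels P v Z] = comb levels P (f \o v) Z.
Proof.
rewrite /comb map_flatten -map_comp; congr flatten; apply: eq_map => c /=.
by rewrite -map_comp.
Qed.

Lemma comb_map (T : Type) g levels P (v : nat -> T) Z :
  comb [seq g u | u <- levels] P v Z = comb levels (P \o g) (v \o g) Z.
Proof.
by congr flatten; apply: eq_map => c; rewrite filter_map -map_comp.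
Qed.

Lemma eq_in_comb (T : Type) levels P P' (v v' : nat -> T) Z :
    {in levels, P =1 P'} -> {in levels, v =1 v'} ->
  comb levels P v Z = comb levels P' v' Z.
Proof.
move=> eqP' eqv; congr flatten; apply: eq_map => c.
rewrite (@eq_in_filter _ _ (fun u => P' u %| c)%N) => [|u /eqP' -> //].
by apply/eq_in_map => u; rewrite mem_filter => /andP[_ /eqv].
Qed.

Lemma count_multiples (P q : nat) : (0 < P)%N ->
  (\sum_(c <- iota 0 (q * P)) (P %| c) = q)%N.
Proof.
move=> P_gt0; elim: q => [|q IH]; first by rewrite big_nil.
rewrite mulSnr iotaD big_cat /= IH add0n -addn1; congr addn.
case: P P_gt0 {IH} => [//|P] _ /=; rewrite big_cons dvdn_mull // big1_seq ?addn0 //.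
move=> c; rewrite mem_iota /= => /andP[lt_c c_lt].
have /subnKC <- := ltnW lt_c; rewrite dvdn_addr ?dvdn_mull // gtnNdvd //.
  by rewrite subn_gt0.
by rewrite ltn_subLR ?(ltnW lt_c) // addnS -addSn.
Qed.

Lemma comb_energy (R : comNzRingType) levels P (v : nat -> R) Z :
    (forall u, u \in levels -> 0 < P u /\ P u %| Z)%N ->
  \sum_(w <- comb levels P v Z) w ^+ 2
  = \sum_(u <- levels) (Z %/ P u)%:R * v u ^+ 2.
Proof.
move=> dvd_Z; rewrite /comb big_flatten big_map.
under eq_bigr do rewrite big_map big_filter big_mkcond /=.
rewrite exchange_big /=; apply: eq_big_seq => u /dvd_Z [P_gt0 /divnK eqZ].
rewrite -[in LHS]eqZ -[in RHS](count_multiples (Z %/ P u) P_gt0) natr_sum big_distrl.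
by apply: eq_bigr => c _ /=; case: (P u %| c)%N; rewrite ?mul1r ?mul0r.
Qed.

(** Level [u] is a comb with [level_density t L u ^ 2] letters over a time grid of
[(t * t.+1) ^ (2 * L)] instants; the densities are in geometric progression of ratio
t / (t + 1), so that they approximate arbitrary ratios when t is large. The number of
letters is a square so that the letters, of energy 1 in total, are rational. *)
Definition level_period (t L u : nat) : nat := ((t ^ (L - u) * t.+1 ^ u) ^ 2)%N.

Definition level_density (t L u : nat) : nat := (t ^ u * t.+1 ^ (L - u))%N.

(** The levels are those from [D] to [L] among the levels of the grid of exponent
[L + D]. For [D = 0] this is the word that is repeated in [comb_word_subseq]; for
[D > 0] it is the part of the scale which stays inside the range of levels after
multiplication by any density of exponent [D]. *)
Definition comb_word (R : realType) (t L D : nat) : seq R :=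
  comb (iota D (L.+1 - D)) (level_period t (L + D))
    (fun u => (level_density t (L + D) u)%:R^-1) ((t * t.+1) ^ (2 * (L + D)))%N.

Section CombWord.
Variables (R : realType) (t : nat).
Hypothesis t_gt0 : (0 < t)%N.

Lemma level_periodM L u : (u <= L)%N ->
  (level_density t L u ^ 2 * level_period t L u = (t * t.+1) ^ (2 * L))%N.
Proof.
move=> le_uL; rewrite /level_density /level_period -(subnKC le_uL) addKn.
move: (L - u)%N => w; rewrite mulnC -expnMn [(2 * _)%N]mulnC expnM.
by congr (_ ^ 2)%N; rewrite expnMn !expnD; ring.
Qed.

Lemma level_density_gt0 L u : (0 < level_density t L u)%N.
Proof. by rewrite muln_gt0 !expn_gt0 t_gt0. Qed.

Lemma level_period_gt0 L u : (0 < level_period t L u)%N.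
Proof. by rewrite expn_gt0 muln_gt0 !expn_gt0 t_gt0. Qed.

(** Each level has energy 1: d^2 letters 1/d. *)
Lemma comb_word_energy L D : (D <= L)%N ->
  \sum_(w <- comb_word R t L D) w ^+ 2 = (L.+1 - D)%:R.
Proof.
move=> le_DL; have le_u u : u \in iota D (L.+1 - D) -> (u <= L + D)%N.
  by rewrite mem_iota; lia.
rewrite comb_energy => [|u /le_u le_uLD]; last first.
  by rewrite level_period_gt0 -(level_periodM le_uLD) dvdn_mull.
rewrite -[in RHS](size_iota D (L.+1 - D)) -sum1_size natr_sum.
apply: eq_big_seq => u /le_u le_uLD.
rewrite -(level_periodM le_uLD) mulnK ?level_period_gt0 // natrX -exprMn.
by rewrite divff ?expr1n // pnatr_eq0 -lt0n level_density_gt0.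
Qed.

Lemma comb_word_neq0 L D : all (fun w => w != 0) (comb_word R t L D).
Proof.
apply/allP => w /flattenP [s /mapP [c _ ->]] /mapP [u _ ->].
by rewrite invr_eq0 pnatr_eq0 -lt0n level_density_gt0.
Qed.

(** Multiplication by [level_density t D k] sends the letters of level u to those of
level u - k, and repeating the short word [level_density t D k ^ 2] times over the
same duration multiplies its densities accordingly. After refinement of the time
grids both words are combs over one grid and the levels of the first form an interval
of those of the second. *)
Lemma comb_word_subseq L D k : (k <= D <= L)%N ->
  subseq [seq (level_density t D k)%:R * w | w <- comb_word R t L D]
    (flatten (nseq (level_density t D k ^ 2) (comb_word R t L 0))).
Proof.
move=> /andP[le_kD le_DL].
rewrite -comb_repeat; last first.
  apply/allP => u; rewrite mem_iota add0n subn0 ltnS addn0 => /= le_uL.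
  by rewrite -(level_periodM le_uL) dvdn_mull.
rewrite -(@comb_refine _ _ _ _ (level_period t D k)) ?level_period_gt0 //.
rewrite mulnA (mulnC (level_period _ _ _)) level_periodM // addn0 -expnD -mulnDr.
apply: (@subseq_trans _ (comb [seq (u - k)%N | u <- iota D (L.+1 - D)] 
   (fun u => level_period t D k * level_period t L u)%N 
   (fun u => (level_density t L u)%:R^-1) ((t * t.+1) ^ (2 * (D + L))))).
  rewrite map_comb comb_map [(D + L)%N]addnC.
  set w := comb _ _ _ _; set w' := comb _ _ _ _; suff -> : w = w' by [].
  apply: eq_in_comb => u; rewrite mem_iota /level_period /level_density /= => u_in.
    rewrite -expnMn; congr (_ ^ 2)%N.
    have -> : (L + D - u = (D - k) + (L - (u - k)))%N by lia.
    have {2}-> : (u = k + (u - k))%N by lia.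
    by rewrite !expnD; ring.
  have -> : (L + D - u = (D - k) + (L - (u - k)))%N by lia.
  have {1}-> : (u = k + (u - k))%N by lia.
  rewrite !expnD !natrM !natrX.
  by field; rewrite -!natr1 !expf_neq0 // ?pnatr_eq0 -?lt0n // natr1 pnatr_eq0.
apply: comb_subseq.
have -> : [seq (u - k)%N | u <- iota D (L.+1 - D)] = iota (D - k) (L.+1 - D).
  have {1}-> : (D = k + (D - k))%N by lia.
  rewrite iotaDl -map_comp -[RHS]map_id; apply: eq_map => u /=; exact: addKn.
have -> : (L.+1 - 0 = (D - k) + ((L.+1 - D) + k))%N by lia.
rewrite !iotaD add0n; apply: subseq_trans (suffix_subseq _ _).
exact: prefix_subseq.
Qed.

End CombWord.

(** * Alternating blocks and signs *)

Definition oscillate (R : nzRingType) (h : nat) (s : seq R) : seq R :=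
  flatten [seq [seq (-1) ^+ t * w | t <- iota 0 h] | w <- s].

(** The [t]-th of the [h + 1] positions shared by the blocks of a letter [w] multiplied
by the coefficients [b i]. Rows with [b i < 0] start one position later: the shifted
alternating block of |b i| w agrees with the unshifted one of b i w on the overlap. *)
Definition osc_col (R : realType) (N h : nat) (b : 'I_N -> R) (w : R) (t : nat) :
    'I_N -> R :=
  fun i => (-1) ^+ t * (b i * w) * (if 0 <= b i then (t < h)%N else (0 < t)%N : bool)%:R.

Definition slot_cols (R : realType) (N h : nat) (b : 'I_N -> R) (s : seq R) :
    seq ('I_N -> R) :=
  flatten [seq [seq osc_col h b w t | t <- iota 0 h.+1] | w <- s].

Section Oscillation.
Variables (R : realType) (N h : nat).
Implicit Types (b : 'I_N -> R) (s : seq R).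

Lemma oscillate_cat s1 s2 :
  oscillate h (s1 ++ s2) = oscillate h s1 ++ oscillate h s2.
Proof. by rewrite /oscillate map_cat flatten_cat. Qed.

Lemma oscillate_flatten (ss : seq (seq R)) :
  oscillate h (flatten ss) = flatten [seq oscillate h s | s <- ss].
Proof. by elim: ss => //= s ss IH; rewrite oscillate_cat IH. Qed.

Lemma oscillate_subseq s1 s2 :
  subseq s1 s2 -> subseq (oscillate h s1) (oscillate h s2).
Proof.
elim: s2 s1 => [|y s2 IH] [|x s1] //=; first by rewrite sub0seq.
rewrite /oscillate /= -/(oscillate h _).
case: eqP => [->|_] sub; first by apply: cat_subseq => //; apply: IH.
by apply: subseq_trans (IH _ sub) (suffix_subseq _ _).
Qed.

Lemma oscillate_energy s :
  \sum_(v <- oscillate h s) v ^+ 2 = h%:R * \sum_(w <- s) w ^+ 2.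
Proof.
rewrite big_flatten big_map big_distrr; apply: eq_bigr => w _ /=.
rewrite big_map; under eq_bigr do rewrite exprMn sqrr_sign mul1r.
by rewrite big_const_seq count_predT size_iota iter_addr_0 mulr_natl.
Qed.

Lemma oscillate_neq0 s :
  all (fun w => w != 0) s -> all (fun w => w != 0) (oscillate h s).
Proof.
move=> s_neq0; apply/allP => v /flattenP [_ /mapP [w w_s ->]] /mapP [t _ ->].
by rewrite mulf_neq0 ?signr_eq0 // (allP s_neq0).
Qed.

Lemma nonzeros_osc b w i : w != 0 ->
  nonzeros [seq osc_col h b w t i | t <- iota 0 h.+1]
  = if b i == 0 then [::] else [seq (-1) ^+ t * (`|b i| * w) | t <- iota 0 h].
Proof.
move=> w_neq0; rewrite /osc_col; case: eqVneq => [->|b_neq0].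
  by rewrite /nonzeros; elim: (iota _ _) => //= t r ->; rewrite mul0r mulr0 mul0r eqxx.
have term_neq0 t : (-1) ^+ t * (b i * w) != 0.
  by rewrite !mulf_neq0 ?signr_eq0.
have keep (r : seq nat) (e : R) : e != 0 ->
    nonzeros [seq (-1) ^+ t * e | t <- r] = [seq (-1) ^+ t * e | t <- r].
  move=> e_neq0; apply/all_filterP/allP => _ /mapP [t _ ->].
  by rewrite mulf_neq0 ?signr_eq0.
case: lerP => b_sg; last first.
  rewrite /= mulr0 eqxx (iotaDl 1) -map_comp.
  rewrite -(keep (iota 0 h)) ?mulf_neq0 ?normr_eq0 //; congr nonzeros.
  apply: eq_map => t /=.
  by rewrite exprS (ltr0_norm b_sg) mulr1 mulN1r !mulNr mulrN.
rewrite -addn1 iotaD map_cat /nonzeros filter_cat /= add0n ltnn mulr0 eqxx cats0.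
rewrite (ger0_norm b_sg) -/(nonzeros _) -[RHS]keep ?mulf_neq0 //; congr nonzeros.
by apply/eq_in_map => t; rewrite mem_iota => /= ->; rewrite mulr1.
Qed.

Lemma slot_cols_cons b w s :
  slot_cols h b (w :: s) = [seq osc_col h b w t | t <- iota 0 h.+1] ++ slot_cols h b s.
Proof. by []. Qed.

Lemma oscillate_cons w s :
  oscillate h (w :: s) = [seq (-1) ^+ t * w | t <- iota 0 h] ++ oscillate h s.
Proof. by []. Qed.

Lemma nonzeros_slot_cols b s i : all (fun w => w != 0) s ->
  nonzeros (coords (slot_cols h b s) i)
  = if b i == 0 then [::] else oscillate h [seq `|b i| * w | w <- s].
Proof.
elim: s => [_|w s IH]; first by case: ifP.
case/andP=> [w_neq0 s_neq0]; rewrite slot_cols_cons nonzeros_coords_cat IH //.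
rewrite /coords -map_comp nonzeros_osc //.
by rewrite map_cons oscillate_cons; case: ifP.
Qed.

(** Blocks of equal sign overlap in [h] positions, blocks of opposite sign in
[h - 1]. *)
Lemma sum_osc_overlap (x y : bool) :
  (\sum_(0 <= t < h.+1) ((if x then t < h else 0 < t) && (if y then t < h else 0 < t)) =
    h - (x (+) y))%N.
Proof.
have sum_lt : (\sum_(0 <= t < h.+1) (t < h) = h)%N.
  rewrite big_nat_recr //= ltnn addn0 (eq_big_nat _ _ (F2 := fun=> 1%N)) => [|t /andP[_ ->] //].
  by rewrite sum_nat_const_nat muln1 subn0.
have sum_gt : (\sum_(0 <= t < h.+1) (0 < t) = h)%N.
  by rewrite big_nat_recl //= sum_nat_const_nat muln1 subn0.
have sum_mid : (\sum_(0 <= t < h.+1) ((0 < t) && (t < h)) = h - 1)%N.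
  rewrite big_nat_recl //=; case: h => [|h']; first by rewrite big_geq.
  rewrite big_nat_recr //= ltnn addn0 (eq_big_nat _ _ (F2 := fun=> 1%N)) => [|t H].
    by rewrite sum_nat_const_nat muln1 subn0 subn1.
  by rewrite ltnS; case/andP: H => _ ->.
case: x y => [] [] /=; rewrite ?subn0.
- by under eq_bigr do rewrite andbb.
- by under eq_bigr do rewrite andbC.
- by [].
- by under eq_bigr do rewrite andbb.
Qed.

Lemma gram_slot_cols b s i j :
  gram_cols (slot_cols h b s) i j
  = b i * b j * (h - ((0 <= b i)%R (+) (0 <= b j)%R))%:R * \sum_(w <- s) w ^+ 2.
Proof.
rewrite /gram_cols big_flatten big_map big_distrr; apply: eq_bigr => w _.
rewrite big_map -sum_osc_overlap /= -mulrA natr_sum mulr_suml mulr_sumr.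
rewrite /index_iota subn0; apply: eq_bigr => t _.
rewrite /osc_col -mulnb natrM.
have : (-1) ^+ t * (-1) ^+ t = 1 :> R by rewrite -expr2 sqrr_sign.
by move: ((-1) ^+ t) => e ee; rewrite -[RHS]mul1r -ee; ring.
Qed.

End Oscillation.

(** * Approximation of arbitrary Gram matrices *)

(** Bernoulli's inequality for (1 + 1/t)^n, without division. *)
Lemma bernoulli_nat (t n : nat) : (t ^ n * (t + n) <= t * t.+1 ^ n)%N.
Proof.
elim: n => [|n IH]; first by rewrite !expn0; lia.
rewrite !expnS mulnCA; apply: leq_trans (leq_mul (leqnn t.+1) IH).
rewrite -mulnA mulnCA [(t.+1 * _)%N]mulnCA leq_mul //; nia.
Qed.

(** With exponent t^2 the densities range over a factor of at least t, hence reals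
below all of them are at most 1/t times the largest. *)
Lemma level_density_lt t : (0 < t)%N ->
  (t * level_density t (t * t) (t * t) <= t.+1 ^ (t * t))%N.
Proof.
move=> t_gt0; have := bernoulli_nat t (t * t).
rewrite /level_density subnn expn0 muln1 -mulnS mulnCA leq_pmul2l // => le_s.
by apply: leq_trans le_s; rewrite mulnC leq_mul.
Qed.

Lemma level_densityS t D k : (k < D)%N ->
  (t * level_density t D k = level_density t D k.+1 * t.+1)%N.
Proof.
move=> lt_kD; rewrite /level_density -(subnSK lt_kD) !expnS.
by ring.
Qed.

(** The first density below y (t+1)^(t^2) is within a factor 1 + 1/t of it. *)
Lemma nonneg_density_approx (R : realType) (t : nat) (y : R) : (0 < t)%N ->
    0 <= y -> y <= 1 ->
  exists n : nat,
    [/\ n = 0%N \/ (exists2 k, (k <= t * t)%N & n = level_density t (t * t) k),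
     n%:R <= y * (t.+1 ^ (t * t))%:R &
     y * (t.+1 ^ (t * t))%:R <= n%:R + (t.+1 ^ (t * t))%:R / t%:R].
Proof.
move=> t_gt0 y_ge0 y_le1; set s : R := (t.+1 ^ (t * t))%:R.
have t_gt0R : (0 : R) < t%:R by rewrite ltr0n.
have s_ge0 : 0 <= s by rewrite ler0n.
pose Q k := (k <= t * t)%N && ((level_density t (t * t) k)%:R <= y * s).
have [Qtt|] := boolP (Q (t * t)%N); last first.
  rewrite /Q leqnn /= -ltNge => lt_y; exists 0%N; split; first by left.
    by rewrite mulr_ge0.
  rewrite add0r ler_pdivlMr //; have := level_density_lt t_gt0.
  rewrite -(ler_nat R) natrM -/s; apply: le_trans.
  by rewrite mulrC ler_pM2l // ltW.
have exQ : exists k, Q k by exists (t * t)%N.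
case: (ex_minnP exQ) => k /andP[le_k le_y] min_k; exists (level_density t (t * t) k).
split=> //; first by right; exists k.
case: k => [|k] in le_k le_y min_k *.
  rewrite /level_density expn0 mul1n subn0 -/s -[leLHS]addr0 lerD //.
    by rewrite -[leRHS]mul1r ler_wpM2r.
  by rewrite divr_ge0 // ltW.
have : ~~ Q k by apply/negP => /min_k; rewrite ltnn.
rewrite /Q (ltnW le_k) /= -ltNge => lt_y.
rewrite -(ler_pM2l t_gt0R) mulrDr [t%:R * (s / _)]mulrC divfK ?gt_eqF //.
apply: (@le_trans _ _ (t%:R * (level_density t (t * t) k)%:R)).
  by rewrite ler_pM2l // ltW.
rewrite -natrM level_densityS // natrM -natr1 mulrDr mulr1 [t%:R * _]mulrC lerD2l.
by apply: le_trans le_y _; rewrite -[leRHS]mul1r ler_wpM2r.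
Qed.

Lemma signed_density_approx (R : realType) (t : nat) (x : R) : (0 < t)%N ->
    `|x| <= 1 ->
  exists bn : R * nat,
    [/\ bn.2 = 0%N \/ (exists2 k, (k <= t * t)%N & bn.2 = level_density t (t * t) k),
     `|bn.1| = bn.2%:R,
     `|bn.1 / (t.+1 ^ (t * t))%:R| <= `|x| &
     `|bn.1 / (t.+1 ^ (t * t))%:R - x| <= t%:R^-1].
Proof.
move=> t_gt0 x_le1.
have [n [n_lev le_n le_x]] := nonneg_density_approx t_gt0 (normr_ge0 x) x_le1.
have s_gt0 : (0 : R) < (t.+1 ^ (t * t))%:R by rewrite ltr0n expn_gt0.
exists ((-1) ^+ (x < 0)%R * n%:R, n) => /=; split=> //.
- by rewrite normrMsign ger0_norm.
- by rewrite -mulrA normrMsign ger0_norm ?divr_ge0 ?ler_pdivrMr // ltW.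
- rewrite {2}[x]numEsign // -mulrA -mulrBr normrMsign distrC ger0_norm.
    by rewrite lerBlDl -(ler_pM2r s_gt0) mulrDl divfK ?gt_eqF // [t%:R^-1 * _]mulrC.
  by rewrite subr_ge0 ler_pdivrMr.
Qed.

Lemma flatten_nseq_sum (T : Type) (I : Type) (r : seq I) (n : I -> nat) (s : seq T) :
  flatten [seq flatten (nseq (n i) s) | i <- r] = flatten (nseq (\sum_(i <- r) n i) s).
Proof.
elim: r => [|i r IH] /=; first by rewrite big_nil.
by rewrite big_cons IH nseqD flatten_cat.
Qed.

Lemma flatten_nseq_subseq (T : eqType) (m n : nat) (s : seq T) : (m <= n)%N ->
  subseq (flatten (nseq m s)) (flatten (nseq n s)).
Proof. by move=> /subnKC <-; rewrite nseqD flatten_cat prefix_subseq. Qed.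

Lemma coords_flatten (R : Type) (N : nat) (colss : seq (seq ('I_N -> R))) i :
  coords (flatten colss) i = flatten [seq coords cols i | cols <- colss].
Proof. exact: map_flatten. Qed.

Lemma nonzeros_flatten (R : nzRingType) (ss : seq (seq R)) :
  nonzeros (flatten ss) = flatten [seq nonzeros s | s <- ss].
Proof. exact: filter_flatten. Qed.

Lemma sum_flatten_nseq (R : nzRingType) (m : nat) (s : seq R) (f : R -> R) :
  \sum_(w <- flatten (nseq m s)) f w = m%:R * \sum_(w <- s) f w.
Proof.
elim: m => [|m IH]; first by rewrite big_nil mul0r.
by rewrite /= big_cat IH -natr1 mulrDl mul1r addrC.
Qed.

Lemma product_error (R : realFieldType) (b b' x x' c e : R) :
    `|b| <= 1 -> `|b'| <= 1 -> `|x| <= 1 -> `|b - x| <= e -> `|b' - x'| <= e ->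
    c <= 1 -> 1 - c <= 2 * e -> `|b * b' * c - x * x'| <= 4 * e.
Proof.
move=> b_le b'_le x_le bx_le bx'_le c_le1 c_ge.
have -> : b * b' * c - x * x'
  = (b - x) * b' + x * (b' - x') - b * b' * (1 - c) by ring.
have -> : 4 * e = e * 1 + 1 * e + 1 * 1 * (2 * e) by ring.
apply: le_trans (ler_normB _ _) (lerD (le_trans (ler_normD _ _) (lerD _ _)) _).
- by rewrite normrM ler_pM.
- by rewrite normrM ler_pM.
- rewrite !normrM (ger0_norm (_ : 0 <= 1 - c)) ?subr_ge0 //.
  by rewrite !ler_pM // ?mulr_ge0 ?subr_ge0.
Qed.

(** The vectors [X i] are rounded towards zero to coordinates +- density / S with
S = (t+1)^(t^2). Row i is the concatenation over p of the core word multiplied by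
coordinate p, written in slot p. Since the rounded vectors have norm at most 1, this
is a subsequence of S^2 copies of the full word. The Gram matrix, divided by the
energy of these copies, differs from that of [X] by the rounding error 1/t, by the
proportion 1/t of positions lost to opposite signs and by the proportion at most 1/t
of levels that are not in the core. *)
Lemma spreadable_approx (R : realType) (N d t : nat) (X : 'M[R]_(N, d)) :
    (0 < t)%N -> (forall i, \sum_p X i p ^+ 2 <= 1) ->
  exists2 M : 'M[R]_N, spreadable M & (forall i, M i i = 1) /\
    (forall i j, i != j -> `|M i j - \sum_p X i p * X j p| <= d%:R * (4 / t%:R)).
Proof.
move=> t_gt0 X_le1; have t_gt0R : (0 : R) < t%:R by rewrite ltr0n.
have X_norm i p : `|X i p| <= 1.
  rewrite -(@expr_le1 _ 2) // real_normK ?num_real //; apply: le_trans (X_le1 i).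
  rewrite (bigD1 p) //= lerDl; apply: sumr_ge0 => q _; exact: sqr_ge0.
(* The proportion of levels outside the core is D / (L + 1) <= 1/t. *)
set D := (t * t)%N; set L := (t * D)%N.
have D_le_L : (D <= L)%N by rewrite leq_pmull.
set S : R := (t.+1 ^ D)%:R; have S_gt0 : 0 < S by rewrite ltr0n expn_gt0.
have approx (ip : 'I_N * 'I_d) :
    exists bn : R * nat,
    [/\ bn.2 = 0%N \/ (exists2 k, (k <= D)%N & bn.2 = level_density t D k),
     `|bn.1| = bn.2%:R, `|bn.1 / S| <= `|X ip.1 ip.2| &
     `|bn.1 / S - X ip.1 ip.2| <= t%:R^-1].
  exact: signed_density_approx.
have [B HB] := choice approx.
pose b p i := (B (i, p)).1; pose n i p := (B (i, p)).2.
pose T := comb_word R t L 0; pose core := comb_word R t L D.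
pose cols := flatten [seq slot_cols t (b p) core | p <- enum 'I_d].
pose Q := ((t.+1 ^ D) ^ 2)%N.
pose a := oscillate t (flatten (nseq Q T)).
have a_neq0 : all (fun v => v != 0) a.
  apply: oscillate_neq0; apply/allP => w /flattenP [s].
  by move=> /nseqP [-> _]; apply: (allP (comb_word_neq0 _ _ _ _)).
have n_le i : (\sum_(p <- enum 'I_d) n i p ^ 2 <= Q)%N.
  rewrite -(ler_nat R) big_enum natr_sum /Q natrX -/S -[leRHS]mul1r.
  rewrite -ler_pdivrMr ?exprn_gt0 // mulr_suml; apply: le_trans (X_le1 i).
  apply: ler_sum => p _; have [_ nE le_X _] := HB (i, p).
  rewrite natrX -nE -expr_div_n -[leRHS]real_normK ?num_real //.
  rewrite lerXn2r ?nnegrE ?divr_ge0 // ?(ltW S_gt0) //.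
  by move: le_X; rewrite normrM normfV (gtr0_norm S_gt0).
have rows i : subseq (nonzeros (coords cols i)) a.
  rewrite /cols /a; move: (enum 'I_d) (n_le i) => r n_le_r.
  rewrite coords_flatten nonzeros_flatten -!map_comp.
  apply: (@subseq_trans _
    (oscillate t (flatten (nseq (\sum_(p <- r) n i p ^ 2) T)))); last first.
    by apply: oscillate_subseq; apply: flatten_nseq_subseq.
  rewrite -flatten_nseq_sum oscillate_flatten -map_comp.
  apply: subseq_flatten_map => p /=.
  rewrite nonzeros_slot_cols; last exact: comb_word_neq0.
  case: eqP => [_|b_neq0]; first exact: sub0seq.
  have [n_lev nE _ _] := HB (i, p); rewrite nE; apply: oscillate_subseq.
  rewrite /n; case: n_lev => [n0|[k le_k ->]].
    by case: b_neq0; apply/normr0_eq0; rewrite nE n0.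
  by apply: comb_word_subseq => //; apply/andP.
have := spreadable_subseq a_neq0 rows; set M0 := \matrix_(_, _) _ => M0_spread.
pose K : R := t%:R * (Q%:R * L.+1%:R).
have K_gt0 : 0 < K by rewrite !mulr_gt0 ?ltr0n // !expn_gt0.
exists (K^-1 *: M0); first by apply: spreadableZ => //; rewrite invr_ge0 ltW.
split=> [i|i j ij]; rewrite !mxE.
  rewrite eqxx /a oscillate_energy sum_flatten_nseq comb_word_energy //.
  by rewrite subn0 mulVf ?gt_eqF.
rewrite (negbTE ij) /gram_cols big_flatten big_map big_enum mulr_sumr -sumrB.
have -> : d%:R * (4 / t%:R) = \sum_(p < d) 4 / t%:R :> R.
  by rewrite sumr_const card_ord mulr_natl.
apply: le_trans (ler_norm_sum _ _ _) (ler_sum _ _) => p _.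
rewrite -/(gram_cols _ _ _) gram_slot_cols comb_word_energy //.
set o := _ (+) _.
pose c : R := (t - o)%:R / t%:R * ((L.+1 - D)%:R / L.+1%:R).
have -> : K^-1 * (b p i * b p j * (t - o)%:R * (L.+1 - D)%:R)
   = (b p i / S) * (b p j / S) * c.
  rewrite /K /Q natrX -/S /c; field.
  by rewrite addrC natr1 pnatr_eq0 -/S !gt_eqF.
have [_ _ bi_le bi_X] := HB (i, p); have [_ _ bj_le bj_X] := HB (j, p).
apply: (product_error (le_trans bi_le (X_norm _ _)) (le_trans bj_le (X_norm _ _))
  (X_norm _ _) bi_X bj_X).
- by rewrite /c mulr_ile1 ?divr_ge0 // ler_pdivrMr ?ltr0n // mul1r ler_nat leq_subr.
- have le1 : 1 - t%:R^-1 <= (t - o)%:R / t%:R :> R.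
    rewrite ler_pdivlMr // mulrBl mul1r mulVf ?gt_eqF // natrB ?lerD2l ?lerN2.
      by rewrite lern1 leq_b1.
    by rewrite (leq_trans (leq_b1 _)).
  have le2 : 1 - t%:R^-1 <= (L.+1 - D)%:R / L.+1%:R :> R.
    rewrite ler_pdivlMr ?ltr0n // mulrBl mul1r natrB; last by rewrite leqW.
    rewrite lerD2l lerN2 mulrC ler_pdivlMr // -natrM ler_nat mulnC leqW //.
  have inv_t : t%:R^-1 <= 1 :> R by rewrite invf_le1 // ler1n.
  have : (1 - t%:R^-1) * (1 - t%:R^-1) <= c by rewrite ler_pM // subr_ge0.
  have := sqr_ge0 (t%:R^-1 : R); rewrite expr2; lra.
Qed.

(** * Inner products and monochromatic spreads *)

Definition dotp (R : realType) (n : nat) (u v : 'rV[R]_n) : R := (u *m v^T) 0 0.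

Section Dotp.
Variables (R : realType) (n : nat).
Implicit Types u v w : 'rV[R]_n.

Lemma dotpE u v : dotp u v = \sum_i u 0 i * v 0 i.
Proof. by rewrite /dotp mxE; apply: eq_bigr => i _; rewrite mxE. Qed.

Lemma dotpC u v : dotp u v = dotp v u.
Proof. by rewrite !dotpE; apply: eq_bigr => i _; rewrite mulrC. Qed.

Lemma dotpDl u v w : dotp (u + v) w = dotp u w + dotp v w.
Proof. by rewrite /dotp mulmxDl mxE. Qed.

Lemma dotpDr u v w : dotp u (v + w) = dotp u v + dotp u w.
Proof. by rewrite dotpC dotpDl !(dotpC u). Qed.

Lemma dotpZl (a : R) u v : dotp (a *: u) v = a * dotp u v.
Proof. by rewrite /dotp -scalemxAl mxE. Qed.

Lemma dotpZr (a : R) u v : dotp u (a *: v) = a * dotp u v.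
Proof. by rewrite dotpC dotpZl dotpC. Qed.

Lemma dotpNl u v : dotp (- u) v = - dotp u v.
Proof. by rewrite -scaleN1r dotpZl mulN1r. Qed.

Lemma dotpNr u v : dotp u (- v) = - dotp u v.
Proof. by rewrite dotpC dotpNl dotpC. Qed.

Lemma dotpBl u v w : dotp (u - v) w = dotp u w - dotp v w.
Proof. by rewrite dotpDl dotpNl. Qed.

Lemma dotpBr u v w : dotp u (v - w) = dotp u v - dotp u w.
Proof. by rewrite dotpDr dotpNr. Qed.

Lemma dotp0l u : dotp 0 u = 0.
Proof. by rewrite /dotp mul0mx mxE. Qed.

Lemma dotp0r u : dotp u 0 = 0.
Proof. by rewrite dotpC dotp0l. Qed.

Lemma dotp_sqrB u v :
  dotp (u - v) (u - v) = dotp u u - 2 * dotp u v + dotp v v.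
Proof. by rewrite dotpBl !dotpBr (dotpC v u); ring. Qed.

Lemma dotp_sqrD u v :
  dotp (u + v) (u + v) = dotp u u + 2 * dotp u v + dotp v v.
Proof. by rewrite dotpDl !dotpDr (dotpC v u); ring. Qed.

Lemma dotp_ge0 u : 0 <= dotp u u.
Proof. by rewrite dotpE; apply: sumr_ge0 => i _; rewrite -expr2 sqr_ge0. Qed.

Lemma dotp_eq0 u : (dotp u u == 0) = (u == 0).
Proof.
apply/eqP/eqP => [|->]; last by rewrite dotp0l.
rewrite dotpE => /eqP; rewrite psumr_eq0 => [/allP u0|i _]; last first.
  by rewrite -expr2 sqr_ge0.
apply/rowP => i; rewrite mxE; have := u0 i (mem_index_enum i).
by rewrite -expr2 sqrf_eq0 => /eqP.
Qed.

Lemma dotp_sumr (I : Type) (r : seq I) (P : pred I) (F : I -> 'rV[R]_n) u :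
  dotp u (\sum_(i <- r | P i) F i) = \sum_(i <- r | P i) dotp u (F i).
Proof. exact: (big_morph (dotp u) (dotpDr u) (dotp0r u)). Qed.

Lemma dotp_delta u i : dotp (delta_mx 0 i) u = u 0 i.
Proof. by rewrite /dotp -rowE !mxE. Qed.

Lemma euclidean_distE u v : euclidean_dist u v = Num.sqrt (dotp (u - v) (u - v)).
Proof.
by rewrite dotpE; congr Num.sqrt; apply: eq_bigr => i _; rewrite !mxE expr2.
Qed.

End Dotp.

Definition spread_vec (R : realType) (n : nat) (w : seq R) (Z : seq 'I_n) : 'rV[R]_n :=
  \sum_(p <- zip w Z) p.1 *: delta_mx 0 p.2.

Section SpreadVec.
Variables (R : realType) (n : nat).
Implicit Types (w : seq R) (Z : seq 'I_n).

Lemma spread_vec_cons v w y Z :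
  spread_vec (v :: w) (y :: Z) = v *: delta_mx 0 y + spread_vec w Z.
Proof. by rewrite /spread_vec /= big_cons. Qed.

Lemma spread_vec_nonzeros w Z : size w = size Z ->
  spread_vec w Z = spread_vec (nonzeros w) (mask [seq v != 0 | v <- w] Z).
Proof.
elim: w Z => [|v w IH] [|y Z] //= [size_w]; rewrite spread_vec_cons IH //.
by case: eqVneq => [->|_]; rewrite ?scale0r ?add0r // -spread_vec_cons.
Qed.

Lemma spread_vec_notin w Z y : y \notin Z -> spread_vec w Z 0 y = 0.
Proof.
elim: Z w => [|z Z IH] [|v w]; rewrite ?/spread_vec ?big_nil ?mxE //.
rewrite in_cons negb_or -/(spread_vec _ _) spread_vec_cons => /andP[yz yZ].
by rewrite !mxE IH // (negbTE yz) andbF mulr0 addr0.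
Qed.

Lemma dotp_spread_vec N (cols : seq ('I_N -> R)) Z i j :
    size cols = size Z -> uniq Z ->
  dotp (spread_vec (coords cols i) Z) (spread_vec (coords cols j) Z)
  = gram_cols cols i j.
Proof.
elim: cols Z => [|c cols IH] [|y Z] //= => [_ _|[size_c] /andP[y_Z uniq_Z]].
  by rewrite /spread_vec big_nil dotp0l /gram_cols big_nil.
rewrite !spread_vec_cons gram_cols_cons -(IH Z) // !dotpDl !dotpDr !dotpZl !dotpZr.
rewrite !dotp_delta [dotp _ (delta_mx 0 y)]dotpC dotp_delta !spread_vec_notin //.
by rewrite mxE !eqxx mulr1 !mulr0 addr0 add0r.
Qed.

End SpreadVec.

(** Sets of coordinates are colored by the color of the word [a] spread over them. A
homogeneous set with one coordinate for each column carries all N vectors. *)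
Lemma spreadable_ramsey (R : realType) (N : nat) (M : 'M[R]_N) (C : finType) :
    spreadable M -> exists n1 : nat, forall n, (n1 <= n)%N ->
  forall chi : 'rV[R]_n -> C, exists z : 'I_N -> 'rV[R]_n,
    (forall i j, dotp (z i) (z j) = M i j) /\ (exists c, forall i, chi (z i) = c).
Proof.
move=> [a [cols [row_a gram_M]]].
have [n1 Hn1] := ramsey C (size a) (size cols).
exists n1 => n le_n chi.
have [|Y [sub_Y size_Y [c hom_Y]]] :=
    Hn1 'I_n (fun Z => chi (spread_vec a Z)) (enum 'I_n).
  by rewrite size_enum_ord.
exists (fun i => spread_vec (coords cols i) Y); split=> [i j|].
  by rewrite dotp_spread_vec // (subseq_uniq sub_Y) ?enum_uniq.
exists c => i; rewrite spread_vec_nonzeros ?size_map // row_a.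
apply: hom_Y; first exact: mask_subseq.
by rewrite size_mask ?size_map // count_map -(row_a i) size_filter.
Qed.

(** * From approximate to exact Gram matrices *)

Lemma spreadable_sym (R : realType) (N : nat) (M : 'M[R]_N) i j :
  spreadable M -> M i j = M j i.
Proof.
move=> [a [cols [_ gram_M]]]; rewrite !gram_M; apply: eq_bigr => c _.
by rewrite mulrC.
Qed.

(** With a right inverse Y of X, the vectors X' = X - (l/2) Y^T have the Gram matrix
X X^T - l I + (l^2/4) Y^T Y. For small l these vectors have squared norms at most
c' = c - l/2 and their mutual inner products miss those of X by O(l^2) only.
Approximating them leaves a remainder with diagonal l/2 and off-diagonal entries
small compared with l, which [spreadable_dominated] represents exactly. *)
Lemma spreadable_gram (R : realType) (N d : nat) (X : 'M[R]_(N, d)) (c : R) :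
    row_free X -> 0 < c -> (forall i, (X *m X^T) i i = c) ->
  spreadable (X *m X^T).
Proof.
move=> /row_freeP [Y XY] c_gt0 diag_c; set M := X *m X^T.
pose E := Y^T *m Y; pose C : R := 1 + \sum_i \sum_j `|E i j|.
have E_le i j : `|E i j| <= C.
  rewrite /C (bigD1 i) //= (bigD1 j) //= addrCA -!addrA lerDl.
  by rewrite !addr_ge0 // ?sumr_ge0 // => i' _; apply: sumr_ge0.
have C_gt0 : 0 < C.
  by rewrite ltr_pwDl // sumr_ge0 // => i _; apply: sumr_ge0.
(* This choice of l gives l <= c and l C (N^2 + 2) <= 1 at the same time. *)
pose l := (C * (N * N + 2)%:R + c^-1)^-1.
have den_gt0 : 0 < C * (N * N + 2)%:R + c^-1.
  by rewrite addr_gt0 ?mulr_gt0 ?invr_gt0 // ltr0n addn2.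
have l_gt0 : 0 < l by rewrite invr_gt0.
have l_le_c : l <= c.
  rewrite -[c]invrK lef_pV2 ?posrE ?invr_gt0 // lerDr mulr_ge0 // ltW //.
have lC_le : l * C * (N * N + 2)%:R <= 1.
  rewrite -mulrA mulrC ler_pdivrMr // mul1r lerDl invr_ge0 ltW //.
pose X' := X - (l / 2) *: Y^T.
have gram' : X' *m X'^T = M - l%:M + (l ^+ 2 / 4) *: E.
  have -> : X'^T = X^T - (l / 2) *: Y by apply/matrixP => i j; rewrite !mxE.
  rewrite /X' mulmxBl !mulmxBr -!scalemxAr -!scalemxAl XY.
  have -> : Y^T *m X^T = 1%:M by rewrite -trmx_mul XY trmx1.
  by rewrite scalerA -/M -/E -scalemx1; apply/matrixP => i j; rewrite !mxE; field.
have gramE i j :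
    (X' *m X'^T) i j = M i j - l *+ (i == j) + l ^+ 2 / 4 * E i j.
  have addE (A B : 'M[R]_N) : (A + B) i j = A i j + B i j by rewrite mxE.
  by rewrite gram' !addE; congr (_ + _ + _); rewrite !mxE.
pose c' := c - l / 2.
have c'_gt0 : 0 < c' by rewrite /c'; lra.
have lC2 : l ^+ 2 * C * (N * N + 2)%:R <= l.
  by rewrite expr2 -!mulrA ler_piMr ?(ltW l_gt0) // mulrA.
have l2C_ge0 : 0 <= l ^+ 2 * C by rewrite mulr_ge0 ?sqr_ge0 // ltW.
have lC2_2 : l ^+ 2 * C * 2 <= l.
  by apply: le_trans lC2; rewrite ler_wpM2l // ler_nat addn2.
have lE i j : `|l ^+ 2 / 4 * E i j| <= l ^+ 2 * C / 4.
  have l2_ge0 : 0 <= l ^+ 2 / 4 by rewrite divr_ge0 ?sqr_ge0.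
  by rewrite normrM (ger0_norm l2_ge0) [leRHS]mulrAC ler_wpM2l.
have diag' i : (X' *m X'^T) i i <= c'.
  rewrite gramE eqxx diag_c /c' mulr1n.
  by have := lE i i; rewrite ler_norml => /andP[_]; lra.
pose X1 := (Num.sqrt c')^-1 *: X'.
have X1_rows i j : \sum_p X1 i p * X1 j p = c'^-1 * (X' *m X'^T) i j.
  rewrite mxE mulr_sumr; apply: eq_bigr => p _; rewrite !mxE.
  by rewrite mulrACA -expr2 exprVn sqr_sqrtr // ltW.
pose t := (Num.bound (16 * c' * d%:R * (N * N)%:R / l)).+1.
have t_gt0 : (0 : R) < t%:R by rewrite ltr0n.
have t_ge : c' * (d%:R * (4 / t%:R)) * (N * N)%:R <= l / 4.
  have : 16 * c' * d%:R * (N * N)%:R / l < t%:R.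
    apply: lt_trans (archi_boundP _) _; last by rewrite ltr_nat.
    by rewrite !mulr_ge0 // ?invr_ge0 ltW.
  rewrite ltr_pdivrMr // => lt_t.
  rewrite ler_pdivlMr // -(ler_pM2l t_gt0) [leRHS]mulrC.
  apply: le_trans (ltW _); last by rewrite mulrC; exact: lt_t.
  by rewrite le_eqVlt; apply/orP; left; apply/eqP; field; rewrite gt_eqF.
have [|i|M1 M1_spread [M1_diag M1_off]] := @spreadable_approx R N d t X1; first by [].
  under eq_bigr do rewrite expr2.
  by rewrite X1_rows ler_pdivrMl // mulr1.
have -> : M = c' *: M1 + (M - c' *: M1) by rewrite addrC subrK.
apply: spreadableD; first by apply: spreadableZ => //; apply: ltW.
have diffE (A B : 'M[R]_N) i j : (A - c' *: B) i j = A i j - c' * B i j.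
  by rewrite !mxE.
have M_sym i j : M i j = M j i by rewrite -[in LHS](trmxK M) mxE /M trmx_mul trmxK.
pose e := l ^+ 2 * C / 4 + c' * (d%:R * (4 / t%:R)).
apply: (@spreadable_dominated _ _ _ (l / 2) e).
- apply: addr_ge0; first by rewrite divr_ge0.
  by apply: mulr_ge0; [exact: ltW|rewrite mulr_ge0 // divr_ge0].
- by move=> i j; rewrite !diffE M_sym (spreadable_sym i j M1_spread).
- move=> i; rewrite diffE diag_c M1_diag /c'; lra.
- move=> i j ij; rewrite diffE.
  have -> : M i j - c' * M1 i j =
      - (l ^+ 2 / 4 * E i j) - c' * (M1 i j - \sum_p X1 i p * X1 j p).
    rewrite X1_rows mulrBr mulVKf ?gt_eqF // gramE (negbTE ij) mulr0n.
    by ring.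
  apply: le_trans (ler_normB _ _) _; rewrite normrN /e lerD // normrM gtr0_norm //.
  by rewrite ler_pM2l // M1_off.
- rewrite /e mulrDl; have : l ^+ 2 * C * (N * N)%:R <= l; last lra.
  by apply: le_trans lC2; rewrite ler_wpM2l // ler_nat leq_addr.
Qed.

(** * Simplices on spheres *)

Lemma row_free_ker (F : fieldType) (m n : nat) (A : 'M[F]_(m, n)) :
  (forall u : 'rV_m, u *m A = 0 -> u = 0) -> row_free A.
Proof.
move=> inj; rewrite -kermx_eq0; apply/eqP/row_matrixP => i; rewrite row0.
by apply: inj; rewrite -row_mul mulmx_ker row0.
Qed.

(** Homogeneous coordinates turn affine independence into linear independence. *)
Lemma affine_row_free (R : realType) (N m : nat) (x : 'I_N -> 'rV[R]_m)
    (s : R) (c : 'rV[R]_m) :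
    affinely_independent x -> s != 0 ->
  row_free (row_mx (const_mx s : 'cV_N) (\matrix_i (x i - c))).
Proof.
move=> x_indep s_neq0; apply: row_free_ker => u.
rewrite mul_mx_row -(@row_mx0 _ 1 1 m) => /eq_row_mx [us0 ux0].
have sum0 : \sum_j u 0 j = 0.
  have := congr1 (fun v : 'rV_1 => v 0 0) us0; rewrite !mxE.
  under eq_bigr do rewrite mxE.
  by rewrite -mulr_suml => /eqP; rewrite mulf_eq0 (negbTE s_neq0) orbF => /eqP.
apply/rowP => j; rewrite mxE; apply: x_indep => //.
move: ux0; rewrite mulmx_sum_row; under eq_bigr do rewrite rowK scalerBr.
by rewrite sumrB -scaler_suml sum0 scale0r subr0.
Qed.

(** The unknowns w and v_0 in 2 <x_i, w> + v_0 = |x_i|^2 form a linear system of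
linearly independent rows. *)
Lemma circumcenter_exists (R : realType) (N m : nat) (x : 'I_N -> 'rV[R]_m) :
    affinely_independent x ->
  exists (c : 'rV[R]_m) (v : R), forall i, dotp (x i - c) (x i - c) = v.
Proof.
move=> x_indep; have := affine_row_free 0 x_indep (oner_neq0 R).
move=> /row_freeP [B XB]; pose q : 'cV[R]_N := \col_i dotp (x i) (x i).
pose v := B *m q; pose w := 2^-1 *: (dsubmx v)^T.
exists w, (usubmx v 0 0 + dotp w w) => i.
have : (row_mx (const_mx 1 : 'cV_N) (\matrix_i (x i - 0)) *m v) i 0 = q i 0.
  by rewrite mulmxA XB mul1mx.
rewrite -{1}[v]vsubmxK mul_row_col !mxE big_ord1 !mxE mul1r => eq_i.
have xw : \sum_j (\matrix_i (x i - 0)) i j * dsubmx v j 0 = 2 * dotp (x i) w.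
  rewrite dotpZr mulrA divff ?pnatr_eq0 // mul1r dotpE; apply: eq_bigr => j _.
  by rewrite !mxE subr0.
move: eq_i; rewrite xw dotpBl !dotpBr (dotpC w (x i)) => <-; ring.
Qed.

(** Take the rows (sqrt (H^2 - rho^2), x_i - c): they are linearly independent, of norm
H, and their mutual distances are those of the x_i. *)
Lemma sphere_ramsey (R : realType) (N m : nat) (x : 'I_N -> 'rV[R]_m)
    (c : 'rV[R]_m) (rho H : R) (C : finType) :
    affinely_independent x -> (forall i, dotp (x i - c) (x i - c) = rho ^+ 2) ->
    0 <= rho -> rho < H ->
  exists n1 : nat, forall n, (n1 <= n)%N ->
  forall chi : 'rV[R]_n -> C, exists z : 'I_N -> 'rV[R]_n,
    [/\ forall i, dotp (z i) (z i) = H ^+ 2,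
        forall i j, dotp (z i - z j) (z i - z j) = dotp (x i - x j) (x i - x j) &
        exists a, forall i, chi (z i) = a].
Proof.
move=> x_indep x_sph rho_ge0 rho_lt; have H_gt0 := le_lt_trans rho_ge0 rho_lt.
have dH : 0 < H ^+ 2 - rho ^+ 2.
  by rewrite subr_gt0 ltrXn2r // ?nnegrE // ltW.
pose s := Num.sqrt (H ^+ 2 - rho ^+ 2).
have s_neq0 : s != 0 by rewrite gt_eqF // sqrtr_gt0.
pose X : 'M[R]_(N, 1 + m) := row_mx (const_mx s : 'cV_N) (\matrix_i (x i - c)).
have XXE i j : (X *m X^T) i j = H ^+ 2 - rho ^+ 2 + dotp (x i - c) (x j - c).
  rewrite /X tr_row_mx mul_row_col !mxE big_ord1 !mxE -expr2 sqr_sqrtr ?ltW //.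
  by congr (_ + _); rewrite dotpE; apply: eq_bigr => l _; rewrite !mxE.
have X_spread : spreadable (X *m X^T).
  apply: (@spreadable_gram _ _ _ _ (H ^+ 2)); first exact: affine_row_free.
    by rewrite exprn_gt0.
  by move=> i; rewrite XXE x_sph subrK.
have [n1 Hn1] := spreadable_ramsey C X_spread.
exists n1 => n le_n chi; have [z [gram_z [a chi_z]]] := Hn1 n le_n chi.
exists z; split=> [i|i j|]; last by exists a.
  by rewrite gram_z XXE x_sph subrK.
have -> : x i - x j = (x i - c) - (x j - c) by rewrite opprB addrA subrK.
rewrite (dotp_sqrB (z i)) (dotp_sqrB (x i - c)) !gram_z !XXE !x_sph.
by ring.
Qed.

(** * Orthogonal complements *)

(** A unit vector in the kernel of the matrix formed by [A] and the rows found so far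
is added as long as there is room. *)
Lemma orthonormal_complement (R : realType) (p n k : nat) (A : 'M[R]_(p, n)) :
    (p + k <= n)%N ->
  exists U : 'M[R]_(k, n), U *m U^T = 1%:M /\ A *m U^T = 0.
Proof.
elim: k => [|k IH] le_n.
  by exists 0; split; [apply/matrixP => -[]|apply/matrixP => i []].
have [|U [UU AU]] := IH; first by apply: leq_trans le_n; rewrite addnS.
pose B := col_mx A U.
have : kermx B^T != 0.
  rewrite kermx_eq0 /row_free mxrank_tr neq_ltn (leq_ltn_trans (rank_leq_row B)) //.
  by rewrite -addnS.
case/rowV0Pn => v /sub_kermxP vB v_neq0.
pose w := (Num.sqrt (dotp v v))^-1 *: v.
have v_gt0 : 0 < dotp v v by rewrite lt_def dotp_eq0 v_neq0 dotp_ge0.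
have ww : dotp w w = 1.
  rewrite dotpZl dotpZr mulrA -expr2 exprVn sqr_sqrtr ?ltW // mulVf ?gt_eqF //.
have wB : w *m B^T = 0 by rewrite -scalemxAl vB scaler0.
move: wB; rewrite tr_col_mx mul_mx_row -(@row_mx0 _ 1 p k) => /eq_row_mx [wA wU].
have {}wA : A *m w^T = 0 by rewrite -[A]trmxK -trmx_mul wA trmx0.
have wU' : U *m w^T = 0 by rewrite -[U in LHS]trmxK -trmx_mul wU trmx0.
(* [col_mx U w] has [k + 1] rows, not [k.+1]. *)
suff [V [VV AV]] : exists V : 'M[R]_(k + 1, n), V *m V^T = 1%:M /\ A *m V^T = 0.
  by move: V VV AV; rewrite addn1 => V VV AV; exists V.
exists (col_mx U w); split.
  rewrite tr_col_mx mul_col_row UU wU wU' [RHS]scalar_mx_block; congr block_mx.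
  by apply/matrixP => i j; rewrite !ord1 [LHS]ww !mxE.
by rewrite tr_col_mx mul_mx_row AU wA row_mx0.
Qed.

(** Orthogonal projection onto the row space of A, without a hypothesis on its rank:
A A^T has the same kernel as A, hence w A^T lies in the row space of A A^T. *)
Lemma normal_equation (R : realType) (p n : nat) (A : 'M[R]_(p, n)) (w : 'rV[R]_n) :
  exists c : 'rV[R]_p, (w - c *m A) *m A^T = 0.
Proof.
have : (w *m A^T <= A *m A^T)%MS.
  have sub : (A^T <= A *m A^T)%MS.
    rewrite -(geq_leqif (mxrank_leqif_sup (submxMl A A^T))) mxrank_tr.
    have ker_sub : (kermx (A *m A^T) <= kermx A)%MS.
      apply/row_subP => i; apply/sub_kermxP.
      set u := row i _; have : u *m (A *m A^T) = 0.
        by rewrite -row_mul mulmx_ker row0.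
      move=> uAA; apply/eqP; rewrite -dotp_eq0 /dotp trmx_mul mulmxA -(mulmxA u).
      by rewrite uAA mul0mx mxE.
    by have := mxrankS ker_sub; rewrite !mxrank_ker leq_sub2lE // rank_leq_row.
  exact: submx_trans (submxMl _ _) sub.
by case/submxP => c eq_c; exists c; rewrite mulmxBl -mulmxA eq_c subrr.
Qed.

(** * Feet of perpendiculars and the distance graph *)

(** The [b j] are the barycentric coordinates of the foot of the perpendicular; they come
from the normal equation for the differences x_j - x_j0. *)
Lemma foot_exists (R : realType) (N n : nat) (x : 'I_N -> 'rV[R]_n) (P : pred 'I_N)
    (j0 : 'I_N) (w : 'rV[R]_n) : P j0 ->
  exists b : 'I_N -> R, \sum_(j | P j) b j = 1 /\
    forall i, P i -> dotp (w - \sum_(j | P j) b j *: x j) (x i - x j0) = 0.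
Proof.
move=> Pj0; pose A := \matrix_j (if P j then x j - x j0 else 0).
have [c cA] := normal_equation A (w - x j0).
pose s := \sum_(j | P j) c 0 j.
exists (fun j => c 0 j + (if j == j0 then 1 - s else 0)); split=> [|i Pi].
  have delta : \sum_(j | P j) (if j == j0 then 1 - s else 0) = 1 - s.
    rewrite -big_mkcondr (big_pred1 j0) // => j.
    by rewrite /=; case: (j =P j0) => [->|]; rewrite ?Pj0 ?andbF.
  by rewrite big_split /= delta -/s addrC subrK.
have -> : \sum_(j | P j) (c 0 j + (if j == j0 then 1 - s else 0)) *: x j
    = x j0 + c *m A.
  under eq_bigr do rewrite scalerDl.
  rewrite big_split /= [X in _ + X](bigD1 j0) //= eqxx [X in _ + (_ + X)]big1 => [|j].
    rewrite addr0 mulmx_sum_row scalerBl scale1r addrCA; congr (_ + _).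
    rewrite scaler_suml -sumrB big_mkcond; apply: eq_bigr => j _.
    by rewrite rowK; case: ifP => _; rewrite ?scaler0 // scalerBr.
  by move=> /andP[_ /negbTE ->]; rewrite scale0r.
have := congr1 (fun v : 'rV_N => v 0 i) cA; rewrite [RHS]mxE => <-.
rewrite dotpE opprD addrA [RHS]mxE; apply: eq_bigr => j _; congr (_ * _).
by rewrite [RHS]mxE [RHS]mxE Pi.
Qed.

Lemma sum_affine (R : realType) (N n : nat) (x : 'I_N -> 'rV[R]_n) (P : pred 'I_N)
    (b : 'I_N -> R) (p : 'rV[R]_n) : \sum_(j | P j) b j = 1 ->
  \sum_(j | P j) b j *: x j - p = \sum_(j | P j) b j *: (x j - p).
Proof.
move=> b1; under [RHS]eq_bigr do rewrite scalerBr.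
by rewrite sumrB -scaler_suml b1 scale1r.
Qed.

Lemma orthogonal_affine (R : realType) (N n : nat) (x : 'I_N -> 'rV[R]_n)
    (P : pred 'I_N) (j0 : 'I_N) (b : 'I_N -> R) (nu : 'rV[R]_n) :
    \sum_(j | P j) b j = 1 -> (forall i, P i -> dotp nu (x i - x j0) = 0) ->
  dotp nu (\sum_(j | P j) b j *: x j - x j0) = 0.
Proof.
move=> b1 nu_orth; rewrite sum_affine // dotp_sumr big1 // => j Pj.
by rewrite dotpZr nu_orth // mulr0.
Qed.

Lemma dist_to_affine_span (R : realType) (N n : nat) (x : 'I_N -> 'rV[R]_n)
    (P : pred 'I_N) (j0 : 'I_N) (b : 'I_N -> R) (w : 'rV[R]_n) :
    \sum_(j | P j) b j = 1 ->
    (forall i, P i -> dotp (w - \sum_(j | P j) b j *: x j) (x i - x j0) = 0) ->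
  dist_to_set w (affine_span P x) =
    euclidean_dist w (\sum_(j | P j) b j *: x j).
Proof.
move=> b1 orth; set f := \sum_(j | P j) _ in orth *.
have f_span : affine_span P x f by exists b.
have f_min y : affine_span P x y -> euclidean_dist w f <= euclidean_dist w y.
  move=> [a [a1 ->]]; set g := \sum_(j | P j) _.
  rewrite !euclidean_distE ler_wsqrtr //.
  have -> : w - g = (w - f) + (f - x j0 - (g - x j0)).
    by rewrite opprB addrA subrKA addrA subrK.
  have f_orth : dotp (w - f) (f - x j0) = 0 := orthogonal_affine b1 orth.
  have g_orth : dotp (w - f) (g - x j0) = 0 := orthogonal_affine a1 orth.
  rewrite [leRHS]dotp_sqrD (dotpBr _ _ (g - x j0)) f_orth g_orth subr0 mulr0 addr0.
  by rewrite lerDl dotp_ge0.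
apply/eqP; rewrite eq_le; apply/andP; split.
  apply: ge_inf; last by exists f.
  by exists (euclidean_dist w f) => _ [y y_span <-]; apply: f_min.
apply: lb_le_inf; first by exists (euclidean_dist w f), f.
by move=> _ [y y_span <-]; apply: f_min.
Qed.

(** The distance from an apex to the vertices below it depends only on the mutual
distances of these vertices, on the barycentric coordinates of the foot and on the
height. *)
Lemma dist_apex (R : realType) (N n : nat) (x : 'I_N -> 'rV[R]_n)
    (P : pred 'I_N) (j0 : 'I_N) (b : 'I_N -> R) (nu : 'rV[R]_n) (i : 'I_N) :
    \sum_(j | P j) b j = 1 -> (forall j, P j -> dotp nu (x j - x j0) = 0) -> P i ->
  let d j l := dotp (x j - x l) (x j - x l) in
  let p := \sum_(j | P j) b j *: x j + nu in
  dotp (p - x i) (p - x i) = dotp nu nu +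
    \sum_(j | P j) \sum_(l | P l) b j * (b l * ((d j i + d l i - d j l) / 2)).
Proof.
move=> b1 orth Pi d p.
have -> : p - x i = nu + (\sum_(j | P j) b j *: x j - x i).
  by rewrite /p addrAC addrC.
have -> : \sum_(j | P j) b j *: x j - x i
    = \sum_(j | P j) b j *: x j - x j0 - (x i - x j0).
  by rewrite opprB addrA subrK.
rewrite dotp_sqrD dotpBr (orthogonal_affine b1 orth) orth // subr0 mulr0 addr0.
congr (_ + _); rewrite opprB addrA subrK sum_affine // dotp_sumr; apply: eq_bigr => j Pj.
rewrite dotpZr dotpC dotp_sumr mulr_sumr; apply: eq_bigr => l Pl.
rewrite dotpZr; congr (_ * (_ * _)).
have -> : d j l = dotp (x j - x i - (x l - x i)) (x j - x i - (x l - x i)).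
  by rewrite opprB addrA subrK.
by rewrite dotp_sqrB /d; set D := dotp (x j - x i) (x l - x i); field.
Qed.

Lemma transfer_apex (R : realType) (N m n : nat) (x : 'I_N -> 'rV[R]_m)
    (y : 'I_N -> 'rV[R]_n) (P : pred 'I_N) (j0 : 'I_N) (b : 'I_N -> R)
    (nu : 'rV[R]_m) (zeta : 'rV[R]_n) :
    \sum_(j | P j) b j = 1 ->
    (forall i j, P i -> P j ->
       dotp (y i - y j) (y i - y j) = dotp (x i - x j) (x i - x j)) ->
    (forall j, P j -> dotp nu (x j - x j0) = 0) ->
    (forall j, P j -> dotp zeta (y j - y j0) = 0) ->
    dotp zeta zeta = dotp nu nu ->
  forall i, P i ->
  dotp (\sum_(j | P j) b j *: y j + zeta - y i) (\sum_(j | P j) b j *: y j + zeta - y i)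
  = dotp (\sum_(j | P j) b j *: x j + nu - x i) (\sum_(j | P j) b j *: x j + nu - x i).
Proof.
move=> b1 yx nu_orth zeta_orth eq_norm i Pi.
rewrite (dist_apex b1 nu_orth Pi) (dist_apex b1 zeta_orth Pi) eq_norm; congr (_ + _).
by apply: eq_bigr => j Pj; apply: eq_bigr => l Pl; rewrite !yx.
Qed.

(** Points at distance at most 2d have a common neighbor at distance d, the apex of an
isosceles triangle in an orthogonal direction; any segment can be cut into steps of
length at most 2d. *)
Lemma distance_graph_connected (R : realType) (n : nat) (d2 : R) (C : Type)
    (chi : 'rV[R]_n -> C) : (2 <= n)%N -> 0 < d2 ->
    (forall u v, dotp (u - v) (u - v) = d2 -> chi u = chi v) ->
  forall u v, chi u = chi v.
Proof.
move=> n_ge2 d2_gt0 chi_d.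
have near u v : dotp (u - v) (u - v) <= 4 * d2 -> chi u = chi v.
  move=> le_uv; have [//|U [UU vU]] := @orthonormal_complement R 1 n 1 (u - v).
  have {}UU : dotp U U = 1 by rewrite /dotp UU mxE.
  have {}vU : dotp (u - v) U = 0 by rewrite /dotp vU mxE.
  pose D := dotp (u - v) (u - v); pose s := Num.sqrt (d2 - D / 4).
  have s2 : s ^+ 2 = d2 - D / 4 by rewrite sqr_sqrtr // subr_ge0 /D; lra.
  pose p := 2^-1 *: (u - v) + s *: U + v.
  transitivity (chi p); last first.
    apply: chi_d; rewrite /p addrK dotp_sqrD !(dotpZl, dotpZr) vU UU -/D.
    by rewrite mulr1 -expr2 s2; field.
  apply: chi_d; have -> : u - p = 2^-1 *: (u - v) - s *: U.
    rewrite /p opprD addrCA [- _ + (u - v)]addrC opprD addrA -{1}[u - v]scale1r.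
    by rewrite -scalerBl; congr (_ *: _ - _); field.
  rewrite dotp_sqrB !(dotpZl, dotpZr) vU UU -/D.
  by rewrite mulr1 -expr2 s2; field.
move=> u v; pose D := dotp (v - u) (v - u).
(* K steps of squared length D / K^2 <= D / K <= 4 d2. *)
pose K := (Num.bound (D / (4 * d2))).+1.
have K_gt0 : (0 : R) < K%:R by rewrite ltr0n.
have lt_K : D <= 4 * d2 * K%:R ^+ 2.
  have d4 : 0 < 4 * d2 by rewrite mulr_gt0.
  rewrite -ler_pdivrMl // mulrC; apply: (@le_trans _ _ K%:R); last first.
    by rewrite -natrX ler_nat -mulnn leq_pmulr.
  apply: le_trans (ltW (archi_boundP _)) _; first by rewrite divr_ge0 ?dotp_ge0 // ltW.
  by rewrite ler_nat.
pose p t := u + (t%:R / K%:R) *: (v - u).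
have chi_p t : chi (p t) = chi u.
  elim: t => [|t IH]; first by rewrite /p mul0r scale0r addr0.
  rewrite -IH; apply: near.
  have -> : p t.+1 - p t = K%:R^-1 *: (v - u).
    rewrite /p opprD addrACA subrr add0r -scalerBl -mulrBl -natr1.
    by rewrite addrAC subrr add0r mul1r.
  rewrite dotpZl dotpZr -/D mulrA -expr2 exprVn mulrC ler_pdivrMr ?exprn_gt0 //.
by rewrite -(chi_p K) /p divff ?gt_eqF // scale1r addrC subrK.
Qed.

(** * Growing a rainbow simplex *)

Lemma congruent_range (R : realType) (N m n : nat) (x : 'I_N -> 'rV[R]_m)
    (z : 'I_N -> 'rV[R]_n) :
    (forall i j, dotp (z i - z j) (z i - z j) = dotp (x i - x j) (x i - x j)) ->
  congruent (range x) (range z).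
Proof.
move=> zx; pose f p := if [pick i | x i == p] is Some i then z i else 0.
have f_x i : f (x i) = z i.
  rewrite /f; case: pickP => [j /eqP xji|/(_ i)]; last by rewrite eqxx.
  by apply/eqP; rewrite -subr_eq0 -dotp_eq0 zx xji subrr dotp0l.
exists f; split.
  apply/seteqP; split=> [_ [_ [i _ <-] <-]|_ [i _ <-]].
    by rewrite f_x; exists i.
  by exists (x i); [exists i|apply: f_x].
move=> _ _ [i _ <-] [j _ <-]; rewrite !f_x.
by rewrite !euclidean_distE zx.
Qed.

(** The set of radii has to be nonempty, by [circumcenter_exists], for its infimum to
be more than a convention. *)
Lemma circumsphere (R : realType) (N m : nat) (x : 'I_N -> 'rV[R]_m) (i0 : 'I_N)
    (H : R) :
    affinely_independent x -> circumradius (range x) < H ->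
  exists (c : 'rV[R]_m) (rho : R), [/\ 0 <= rho, rho < H &
    forall i, dotp (x i - c) (x i - c) = rho ^+ 2].
Proof.
move=> x_indep; rewrite /circumradius; set S := [set _ | _] => infS_lt.
have [rho [c sph_c] rho_lt] : exists2 rho, S rho & rho < H.
  apply: contrapT => no_rho; suff : H <= inf S by rewrite leNgt infS_lt.
  apply: lb_le_inf => [|rho S_rho]; last first.
    by rewrite leNgt; apply/negP => rho_lt; apply: no_rho; exists rho.
  have [c [v c_eq]] := circumcenter_exists x_indep.
  exists (Num.sqrt v), c => _ [i _ <-]; rewrite /sphere /= euclidean_distE -(c_eq i).
  by rewrite -opprB dotpNl dotpNr opprK.
have dist_c i : euclidean_dist c (x i) = rho by apply: sph_c; exists i.
exists c, rho; split=> [|//|i]; first by rewrite -(dist_c i0) sqrtr_ge0.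
rewrite -(dist_c i) euclidean_distE sqr_sqrtr ?dotp_ge0 //.
by rewrite -opprB dotpNl dotpNr opprK.
Qed.

Lemma affinely_independent_neq (R : realType) (N m : nat) (x : 'I_N -> 'rV[R]_m)
    (i j : 'I_N) : affinely_independent x -> i != j -> x i != x j.
Proof.
move=> x_indep ij; apply/eqP => xij.
pose a l : R := (l == i)%:R - (l == j)%:R.
(* The difference of the i-th and j-th unit vectors is an affine dependency. *)
have single (V : lmodType R) (v : 'I_N -> V) (l0 : 'I_N) :
    \sum_l (l == l0)%:R *: v l = v l0.
  rewrite (bigD1 l0) //= eqxx scale1r big1 ?addr0 // => l /negbTE ->.
  by rewrite scale0r.
have /(_ i) : forall l, a l = 0.
  apply: x_indep.
    rewrite sumrB; have s1 l0 := single R^o (fun=> 1) l0.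
    have {}s1 l0 : \sum_(l < N) (l == l0)%:R = 1 :> R.
      by rewrite -[RHS](s1 l0); apply: eq_bigr => l _; rewrite /GRing.scale /= mulr1.
    by rewrite !s1 subrr.
  under eq_bigr do rewrite scalerBl.
  by rewrite sumrB !single xij subrr.
by rewrite /a eqxx (negbTE ij) subr0 => /eqP; rewrite oner_eq0.
Qed.

Section RainbowExtension.
Variables (R : realType) (N m n : nat) (x : 'I_N -> 'rV[R]_m) (C : eqType).
Variable chi : 'rV[R]_n -> C.

(** [P] selects the vertices placed so far. *)
Definition rainbow_partial (P : pred 'I_N) (y : 'I_N -> 'rV[R]_n) : Prop :=
  (forall i j, P i -> P j ->
     dotp (y i - y j) (y i - y j) = dotp (x i - x j) (x i - x j)) /\
  (forall i j, P i -> P j -> i != j -> chi (y i) != chi (y j)).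

Definition mono_copy : Prop := exists z : 'I_N -> 'rV[R]_n,
  (forall i j, dotp (z i - z j) (z i - z j) = dotp (x i - x j) (x i - x j)) /\
  (forall i j, chi (z i) = chi (z j)).

(** The candidates for the vertex l are f + z U, where f is the foot of the height with
respect to the placed vertices and z runs over a sphere of radius H in a space mapped
isometrically, by U, to the orthogonal directions. They are colored by the index of
the placed vertex with the same color, if any. A copy of the simplex on that sphere
with constant index is monochromatic in the first case; in the second case any of
its points has a new color. *)
Lemma rainbow_extend (P : pred 'I_N) (j0 l : 'I_N) (H : R) (n' : nat)
    (y : 'I_N -> 'rV[R]_n) :
    P j0 -> ~~ P l -> dist_to_set (x l) (affine_span P x) = H -> (N + n' <= n)%N ->
    (forall col : 'rV[R]_n' -> option 'I_N, exists z : 'I_N -> 'rV[R]_n',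
    [/\ forall i, dotp (z i) (z i) = H ^+ 2,
        forall i j, dotp (z i - z j) (z i - z j) = dotp (x i - x j) (x i - x j) &
        exists a, forall i, col (z i) = a]) ->
    rainbow_partial P y -> ~ mono_copy ->
  exists y', rainbow_partial [pred j | P j || (j == l)] y'.
Proof.
move=> Pj0 Pl height le_n sphere [yx y_rainbow] no_mono.
have [b [b1 foot]] := foot_exists x (x l) Pj0.
pose fx := \sum_(j | P j) b j *: x j; pose fy := \sum_(j | P j) b j *: y j.
have nuH : dotp (x l - fx) (x l - fx) = H ^+ 2.
  rewrite -height (dist_to_affine_span b1 foot) euclidean_distE sqr_sqrtr //.
  exact: dotp_ge0.
pose A := \matrix_j (if P j then y j - y j0 else 0).
have [U [UU AU]] := orthonormal_complement A le_n.
have dotU z w : dotp (z *m U) (w *m U) = dotp z w.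
  by rewrite /dotp trmx_mul mulmxA -(mulmxA z) UU mulmx1.
have orthU z j : P j -> dotp (z *m U) (y j - y j0) = 0.
  move=> Pj; have -> : y j - y j0 = row j A by rewrite rowK Pj.
  by rewrite dotpC /dotp trmx_mul mulmxA -row_mul AU row0 mul0mx mxE.
pose q z := fy + z *m U.
pose col z := [pick j | P j && (chi (q z) == chi (y j))].
have [z [z_norm zx [a col_z]]] := sphere col.
case: a => [j|] in col_z.
  case: no_mono; exists (fun i => q (z i)); split=> [i i'|i i'].
    by rewrite /q opprD addrACA subrr add0r -mulmxBl dotU.
  suff chi_j i0 : chi (q (z i0)) = chi (y j) by rewrite !chi_j.
  have := col_z i0; rewrite /col; case: pickP => // j1 /andP[_ /eqP chi_i0] [eq_j].
  by rewrite chi_i0 eq_j.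
pose p := q (z j0).
have p_new j : P j -> chi p != chi (y j).
  move=> Pj; have := col_z j0; rewrite /col; case: pickP => // /(_ j).
  by rewrite Pj => /= ->.
have p_dist j : P j -> dotp (p - y j) (p - y j) = dotp (x l - x j) (x l - x j).
  move=> Pj; rewrite (transfer_apex b1 yx foot (orthU (z j0))) //.
    by rewrite [\sum_(j | P j) _ + _]addrC subrK.
  by rewrite dotU z_norm nuH.
exists (fun j => if j == l then p else y j); split=> i j /=.
  case: (eqVneq i l) => [->|il]; case: (eqVneq j l) => [->|jl]; rewrite ?orbF //.
  - by rewrite !subrr !dotp0l.
  - by move=> _ Pj; apply: p_dist.
  - move=> Pi _; rewrite -opprB dotpNl dotpNr opprK p_dist //.
    by rewrite -[x i - x l]opprB dotpNl dotpNr opprK.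
  - exact: yx.
case: (eqVneq i l) => [->|il]; case: (eqVneq j l) => [->|jl]; rewrite ?orbF //.
- by move=> _ Pj _; apply: p_new.
- by move=> Pi _ _; rewrite eq_sym; apply: p_new.
- exact: y_rainbow.
Qed.

End RainbowExtension.

Theorem corollary1p7 (R : realType) (m k : nat) (k_gt0 : (0 < k)%N)
    (x : 'I_k.+2 -> 'rV[R]_m) (h : 'I_k -> R)
    (x_simplex : affinely_independent x)
    (x_heights : has_heights x h)
    (h_gt : circumradius (range x) <
            \big[Num.min/h (Ordinal k_gt0)]_(i < k) h i) :
  exists n0 : nat, forall n : nat, (n0 <= n)%N ->
    forall r : nat, (0 < r)%N ->
      GR_arrow n r (range x) (range x).
Proof.
have sphere_i (i : 'I_k) : exists n1 : nat, forall n, (n1 <= n)%N ->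
  forall chi : 'rV[R]_n -> option 'I_k.+2, exists z : 'I_k.+2 -> 'rV[R]_n,
    [/\ forall j, dotp (z j) (z j) = h i ^+ 2,
        forall j l, dotp (z j - z l) (z j - z l) = dotp (x j - x l) (x j - x l) &
        exists a, forall j, chi (z j) = a].
  have lt_h : circumradius (range x) < h i by apply: lt_le_trans h_gt (bigmin_le _ _ _).
  have [c [rho [rho_ge0 rho_lt c_eq]]] := circumsphere ord0 x_simplex lt_h.
  exact: sphere_ramsey c_eq rho_ge0 rho_lt.
have [n1 Hn1] := choice sphere_i.
(* Up to k + 2 dimensions are used up by the vertices already placed; the others carry
   the sphere of candidates for the next vertex. *)
exists (k.+2 + \sum_i n1 i)%N => n le_n r _ chi.
have n1_le i : (n1 i <= n - k.+2)%N.
  rewrite leq_subRL; last by apply: leq_trans le_n; rewrite leq_addr.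
  by apply: leq_trans le_n; rewrite leq_add2l (bigD1 i) //= leq_addr.
have [[z [zx z_mono]]|no_mono] := pselect (mono_copy x chi).
  left; exists (range z); split; first exact: congruent_range.
  by move=> _ _ [i _ <-] [j _ <-].
right; suff [y [yx y_rainbow]] : exists y, rainbow_partial x chi predT y.
  exists (range y); split; first by apply: congruent_range => i j; apply: yx.
  move=> u v; rewrite !inE => -[i _ <-] [j _ <-] chi_eq.
  case: (eqVneq i j) => [->//|ij]; have := y_rainbow i j isT isT ij.
  by rewrite chi_eq eqxx.
suff rainbow_upto t : (t <= k)%N ->
    exists y, rainbow_partial x chi (fun j => (j < t.+2)%N) y.
  have [y [yx y_rainbow]] := rainbow_upto k (leqnn k).
  by exists y; split=> i j _ _; [apply: yx|apply: y_rainbow].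
elim: t => [_|t IH lt_tk].
  pose d2 := dotp (x ord0 - x (lift ord0 ord0)) (x ord0 - x (lift ord0 ord0)).
  have d2_gt0 : 0 < d2.
    rewrite lt_def dotp_eq0 dotp_ge0 subr_eq0 andbT.
    exact: affinely_independent_neq.
  have [[u [v [uv chi_uv]]]|no_pair] := pselect (exists u v,
      dotp (u - v) (u - v) = d2 /\ chi u != chi v); last first.
    (* The coloring is constant, and any copy of the simplex is monochromatic; the sphere
       lemma for a constant coloring provides one. *)
    case: no_mono; have [z [_ zx _]] := Hn1 (Ordinal k_gt0) n
      (leq_trans (n1_le _) (leq_subr _ _)) (fun=> None).
    exists z; split=> // i j; apply: (distance_graph_connected _ d2_gt0) => [|u v uv].
      by apply: leq_trans le_n; rewrite !addSn.
    by apply/eqP; apply: contrapT => /negP chi_uv; apply: no_pair; exists u, v.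
  exists (fun j => if j == ord0 then u else v).
  have small (j : 'I_k.+2) : (j < 2)%N -> j = ord0 \/ j = lift ord0 ord0.
    by case: j => [[|[|j]]] //= lt_j _; [left|right]; apply: val_inj.
  split=> i j /small [] -> /small [] -> //=; rewrite ?subrr ?dotp0l //.
    by rewrite -opprB dotpNl dotpNr opprK uv -[in RHS]opprB dotpNl dotpNr opprK.
  by rewrite eq_sym.
have [y y_rainbow] := IH (ltnW lt_tk).
pose l : 'I_k.+2 := lift ord0 (lift ord0 (Ordinal lt_tk)).
have [||y' [y'x y'_rainbow]] := @rainbow_extend R k.+2 m n x _ chi (fun j => (j < l)%N)
    ord0 l _ (n - k.+2) y isT _ (x_heights (Ordinal lt_tk)) _
    (Hn1 (Ordinal lt_tk) _ (n1_le _)) y_rainbow no_mono.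
- by rewrite ltnn.
- by rewrite subnKC //; apply: leq_trans le_n; rewrite leq_addr.
have sub (j : 'I_k.+2) : (j < t.+3)%N -> (j < l)%N || (j == l).
  rewrite ltnS leq_eqVlt => /orP[/eqP e|lt_j]; apply/orP; [right|by left].
  by apply/eqP/val_inj; exact: e.
by exists y'; split=> i j /sub Pi /sub Pj; [apply: y'x|apply: y'_rainbow].
Qed.
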